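(* Let $(\Omega,\mathcal F,\mathbb P)$ be an atomless probability space, let $p\in(0,1)$, $q\in[1,\infty)$, and let $\rho:L^q\to\mathbb R$ be a risk measure that is continuous with respect to the norm $\|X\|_q=(\mathbb E[|X|^q])^{1/q}$. Then $\rho$ satisfies [M], [TI], [P], [$p$-CA] and $\rho(0)=0$ if and only if $\rho=\mathrm{ES}_p$ on $L^q$.
   Context: $(\Omega,\mathcal F,\mathbb P)$ is atomless; $L^q$ is the space of random variables $X$ with $\mathbb E[|X|^q]<\infty$. A risk measure is simply a functional on this space. $X\overset{d}{=}Y$ means equality in law. For $p\in(0,1)$, $\mathrm{VaR}_p(X)=\inf\{x\in\mathbb R:\mathbb P(X\le x)\ge p\}$ and $\mathrm{ES}_p(X)=\frac1{1-p}\int_p^1\mathrm{VaR}_s(X)\,ds$. A tail event of a random variable $X$ is an event $A\in\mathcal F$ with $0<\mathbb P(A)<1$ such that $X(\omega)\ge X(\omega')$ for a.s. all $\omega\in A$ and $\omega'\in A^c$. A $p$-tail event of $X$ is a tail event of $X$ with probability $1-p$. A random vector is $p$-concentrated if its components share a common $p$-tail event. [M]: $\rho(X)\le\rho(Y)$ whenever $X\le Y$ pointwise. [TI]: $\rho(X+c)=\rho(X)+c$ for all $X$ and all $c\in\mathbb R$. [P] (lower semicontinuity): $\liminf_{n\to\infty}\rho(X_n)\ge\rho(X)$ whenever $X,X_1,X_2,\dots\in L^q$ and $X_n\to X$ pointwise. [$p$-CA]: $\rho(X+Y)\le\rho(X'+Y')$ for all $X,Y,X',Y'\in L^q$ such that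 $(X',Y')$ is $p$-concentrated, $X\overset{d}{=}X'$ and $Y\overset{d}{=}Y'$. *)

(* Defs.v *)
From HB Require Import structures.
From mathcomp Require Import all_boot all_order all_algebra.
From mathcomp Require Import all_classical all_reals all_analysis.

Set Implicit Arguments.
Unset Strict Implicit.
Unset Printing Implicit Defensive.

Import Order.TTheory GRing.Theory Num.Theory.
Import numFieldNormedType.Exports.

Local Open Scope classical_set_scope.
Local Open Scope ring_scope.

Definition atomless (d : measure_display) (T : measurableType d)
    (R : realType) (P : probability T R) : Prop :=
  forall A : set T, measurable A -> (0 < P A)%E ->
    exists B : set T,
      [/\ measurable B, B `<=` A, (0 < P B)%E & (P B < P A)%E].

Definition equal_in_law (d : measure_display) (T : measurableType d)
    (R : realType) (P : probability T R) (X Y : {RV P >-> R}) : Prop :=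
  forall B : set R, measurable B -> distribution P X B = distribution P Y B.
Arguments equal_in_law {d T R} P X Y.

(* Meaningful for 0 < s < 1 only: [inf] of an empty or not lower bounded set of
   reals is 0. *)
Definition VaR (d : measure_display) (T : measurableType d) (R : realType)
    (P : probability T R) (s : R) (X : {RV P >-> R}) : R :=
  inf [set x : R | (s%:E <= P [set w | (X w <= x)%R])%E].
Arguments VaR {d T R} P s X.

(* The interval is open because VaR is considered at levels in (0, 1) only. *)
Definition ES (d : measure_display) (T : measurableType d) (R : realType)
    (P : probability T R) (p : R) (X : {RV P >-> R}) : R :=
  (1 - p)^-1 * \int[lebesgue_measure]_(s in `]p, 1[) VaR P s X.
Arguments ES {d T R} P p X.

Definition tail_event (d : measure_display) (T : measurableType d)
    (R : realType) (P : probability T R) (X : {RV P >-> R}) (A : set T) : Prop :=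
  [/\ measurable A, (0 < P A)%E, (P A < 1)%E &
      \forall w \ae P, A w -> \forall w' \ae P, (~` A) w' -> X w' <= X w].
Arguments tail_event {d T R} P X A.

Definition p_tail_event (d : measure_display) (T : measurableType d)
    (R : realType) (P : probability T R) (p : R) (X : {RV P >-> R})
    (A : set T) : Prop :=
  tail_event P X A /\ P A = (1 - p)%:E.
Arguments p_tail_event {d T R} P p X A.

Definition p_concentrated (d : measure_display) (T : measurableType d)
    (R : realType) (P : probability T R) (p : R) (X Y : {RV P >-> R}) : Prop :=
  exists A : set T, p_tail_event P p X A /\ p_tail_event P p Y A.
Arguments p_concentrated {d T R} P p X Y.

(* Elements of [LfunType P hq] are functions, not classes of functions modulo
   almost sure equality. *)
Definition Lcst (d : measure_display) (T : measurableType d) (R : realType)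
    (P : probability T R) (q : R) (hq : (1 <= q%:E)%E) (c : R)
    : LfunType P hq :=
  Lfun_Sub hq (Lfun_cst P c q).
Arguments Lcst {d T R} P {q} hq c.

(* The library does not equip [LfunType] with a topology, hence the
   epsilon-delta form. *)
Definition Lnorm_continuous (d : measure_display) (T : measurableType d)
    (R : realType) (P : probability T R) (q : R) (hq : (1 <= q%:E)%E)
    (rho : LfunType P hq -> R) : Prop :=
  forall (X : LfunType P hq) (e : R), 0 < e ->
    exists2 delta : R, 0 < delta &
      forall Y : LfunType P hq,
        ('N[P]_q%:E[EFin \o (Y - X : LfunType P hq)%R] < delta%:E)%E ->
        `|rho Y - rho X| < e.

Definition monotonicity (d : measure_display) (T : measurableType d)
    (R : realType) (P : probability T R) (q : R) (hq : (1 <= q%:E)%E)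
    (rho : LfunType P hq -> R) : Prop :=
  forall X Y : LfunType P hq, (forall w, X w <= Y w) -> rho X <= rho Y.

Definition translation_invariance (d : measure_display) (T : measurableType d)
    (R : realType) (P : probability T R) (q : R) (hq : (1 <= q%:E)%E)
    (rho : LfunType P hq -> R) : Prop :=
  forall (X : LfunType P hq) (c : R), rho (X + Lcst P hq c) = rho X + c.

Definition lower_semicontinuity (d : measure_display) (T : measurableType d)
    (R : realType) (P : probability T R) (q : R) (hq : (1 <= q%:E)%E)
    (rho : LfunType P hq -> R) : Prop :=
  forall (X_ : nat -> LfunType P hq) (X : LfunType P hq),
    (forall w, X_ n w @[n --> \oo] --> X w) ->
    ((rho X)%:E <= limn_einf (fun n => (rho (X_ n))%:E))%E.

Definition p_concentration_aversion (d : measure_display)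
    (T : measurableType d) (R : realType) (P : probability T R) (q : R)
    (hq : (1 <= q%:E)%E) (p : R) (rho : LfunType P hq -> R) : Prop :=
  forall X Y X' Y' : LfunType P hq,
    p_concentrated P p X' Y' ->
    equal_in_law P X X' -> equal_in_law P Y Y' ->
    rho (X + Y) <= rho (X' + Y').

(* Main.v *)
(* Expected Shortfall is the maximum of the conditional expectations of X given
   events of probability 1-p, attained at p-tail events; this makes it subadditive,
   additive on p-concentrated vectors, and lower semicontinuous by Fatou's lemma
   (below a level under the p-quantile the values of X do not matter).

   Conversely, if rho is averse to p-concentration then swapping the values of a
   function on two sets of equal probability, both inside or both outside a common
   p-tail event A, and averaging does not change rho. Hence a dyadic step function
   on A may be replaced by its mean on A. Off A the same swap pushes mass towards
   minus infinity on ever smaller sets, and lower semicontinuity then shows that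
   the values off A are irrelevant. A bounded X is sandwiched on A between dyadic
   step functions with close means, which determines rho(X); since Expected
   Shortfall satisfies the same axioms, it has the same value. Truncation and
   continuity give the general case. *)

Require Import Defs.
From HB Require Import structures.
From mathcomp Require Import all_boot all_order all_algebra.
From mathcomp Require Import all_classical all_reals all_analysis.
From mathcomp Require Import measurable_realfun ring lra.

Set Implicit Arguments.
Unset Strict Implicit.
Unset Printing Implicit Defensive.

Import Order.TTheory GRing.Theory Num.Theory.
Import numFieldNormedType.Exports.

Local Open Scope classical_set_scope.
Local Open Scope ring_scope.

(** * Atomless probability spaces *)

Section real_probability.
Context (d : measure_display) (T : measurableType d) (R : realType)
  (P : probability T R).

(** Real-valued, so that probabilities obey field arithmetic and [lra] applies. *)
Definition prob (A : set T) : R := fine (P A).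

Lemma probE A : measurable A -> P A = (prob A)%:E.
Proof. by move=> mA; rewrite /prob fineK// fin_num_measure. Qed.

Lemma prob_ge0 A : 0 <= prob A.
Proof. by rewrite fine_ge0. Qed.

Lemma prob0 : prob set0 = 0.
Proof. by rewrite /prob measure0. Qed.

Lemma prob_gt0_ex A : 0 < prob A -> exists w, A w.
Proof. by move=> A0; apply/set0P; apply: contraTneq A0 => ->;
  rewrite prob0 ltxx. Qed.

Lemma probT : prob setT = 1.
Proof. by rewrite /prob probability_setT. Qed.

Lemma le_prob A B : measurable A -> measurable B -> A `<=` B ->
  prob A <= prob B.
Proof.
by move=> mA mB AB; rewrite -lee_fin -(probE mA) -(probE mB);
  apply: le_measure; rewrite ?inE.
Qed.

Lemma probU A B : measurable A -> measurable B -> A `&` B = set0 ->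
  prob (A `|` B) = prob A + prob B.
Proof.
move=> mA mB AB; apply: EFin_inj; rewrite EFinD -(probE mA) -(probE mB) -probE;
  last exact: measurableU.
exact: measureU.
Qed.

Lemma probD A B : measurable A -> measurable B -> B `<=` A ->
  prob (A `\` B) = prob A - prob B.
Proof.
move=> mA mB BA; have := probU mB (measurableD mA mB) (setDIK _ _).
by rewrite setDUK// => ->; rewrite [_ + prob _]addrC addrK.
Qed.

Lemma probC A : measurable A -> prob (~` A) = 1 - prob A.
Proof. by move=> mA; rewrite -setTD probD// probT. Qed.

Lemma prob_bigcup (F : nat -> set T) : (forall n, measurable (F n)) ->
  (forall n, F n `<=` F n.+1) -> prob (F n) @[n --> \oo] --> prob (\bigcup_n F
    n).
Proof.
move=> mF FS; have mU : measurable (\bigcup_n F n) by exact: bigcup_measurable.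
apply: fine_cvg; rewrite -probE//; apply: nondecreasing_cvg_mu => //.
by apply/nondecreasing_seqP => n; apply/subsetPset; exact: FS.
Qed.

Lemma prob_bigcap (F : nat -> set T) : (forall n, measurable (F n)) ->
  (forall n, F n.+1 `<=` F n) -> prob (F n) @[n --> \oo] --> prob (\bigcap_n F
    n).
Proof.
move=> mF FS; have mI : measurable (\bigcap_n F n).
  exact: bigcap_measurableType.
apply: fine_cvg; rewrite -probE//; apply: nonincreasing_cvg_mu => //.
  by rewrite -ge0_fin_numE// fin_num_measure.
by apply/nonincreasing_seqP => n; apply/subsetPset; exact: FS.
Qed.
End real_probability.

Section atomless_probability.
Context (d : measure_display) (T : measurableType d) (R : realType)
  (P : probability T R).
Hypothesis hP : atomless P.
Notation m := (prob P).

(** Atomlessness cuts [B] into [C] and its complement in [B], both of positive mass, and the lighter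
    piece has at most half of the mass of [B]. Iterating makes the mass as small as desired. *)
Lemma atomless_small_set (S : set T) (e : R) : measurable S -> 0 < m S -> 0 < e
  ->
  exists B, [/\ measurable B, B `<=` S, 0 < m B & m B < e].
Proof.
move=> mS S0 e0.
suff H n : exists B, [/\ measurable B, B `<=` S, 0 < m B & m B <= 2^-1 ^+ n * m
  S].
  have [n] : exists n, 2^-1 ^+ n * m S < e.
    have h : (2^-1 : R) ^+ n @[n --> \oo] --> 0 by apply: cvg_expr;
      rewrite ger0_norm; lra.
    have /cvgrPdist_lt/(_ _ (divr_gt0 e0 S0)) [n _ /(_ n (leqnn n))] := h.
    rewrite sub0r normrN ger0_norm ?exprn_ge0// ltr_pdivlMr// => ?.
    by exists n.
  by have [B [? ? ? h]] := H n; exists B; split => //; apply: le_lt_trans h _.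
elim: n => [|n [B [mB BS B0 Bn]]].
  by exists S; split => //; rewrite expr0 mul1r.
have [C [mC CB]] : exists C, [/\ measurable C, C `<=` B, (0 < P C)%E & (P C < P
  B)%E].
  by apply: hP => //; rewrite probE.
rewrite !probE// !lte_fin => C0 C1.
have [h|h] := leP (m C) (2^-1 * m B).
  exists C; split => //; first exact: subset_trans BS.
  by apply: le_trans h _; rewrite exprS -mulrA ler_pM2l.
exists (B `\` C); split.
- exact: measurableD.
- by move=> x [/BS].
- by rewrite probD// subr_gt0.
- rewrite probD// exprS -mulrA.
  have : 2^-1 * m B <= 2^-1 * (2^-1 ^+ n * m S) by rewrite ler_pM2l.
  lra.
Qed.

(* Greedy argument: [f A] covers at least half of the mass that can still be
   added to [A] within [S] without exceeding [t], so the union of the iterates of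
   [f] is maximal, and a small subset of the complement shows that its mass is
   [t]. *)
Lemma atomless_intermediate (S : set T) (t : R) : measurable S -> 0 <= t -> t
  <= m S ->
  exists B, [/\ measurable B, B `<=` S & m B = t].
Proof.
move=> mS t0 tS.
pose good A := [/\ measurable A, A `<=` S & m A <= t].
have next A : good A -> exists A', [/\ good A', A `<=` A' &
    forall C, good C -> A `<=` C -> m C <= 2 * m A' - m A].
  move=> gA; pose E := [set m C | C in [set C | good C /\ A `<=` C]].
  have E0 : E (m A) by exists A => //; split.
  have supE : has_sup E by split; [exists (m A)|exists t => _ [C [[_ _ ?] _]
    <-]].
  have [h|h] := leP (sup E) (m A).
    exists A; split => // C gC AC.
    have : m C <= sup E by apply: ub_le_sup; [case: supE|exists C].
    lra.
  have [|_ [A' [gA' AA'] <-] h'] := @sup_adherent _ E ((sup E - m A) / 2) _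
    supE.
    by rewrite divr_gt0// subr_gt0.
  exists A'; split => // C gC AC.
  have : m C <= sup E by apply: ub_le_sup; [case: supE|exists C].
  lra.
have good0 : good set0 by split => //; rewrite prob0.
have /choice [f fP] : forall A, exists A', good A -> [/\ good A', A `<=` A' &
    forall C, good C -> A `<=` C -> m C <= 2 * m A' - m A].
  move=> A; have [gA|gA] := pselect (good A); last by exists A.
  by have [A' ?] := next A gA; exists A'.
pose A n := iter n f set0.
have gA n : good (A n) by elim: n => //= n /fP[].
have AS n : A n `<=` A n.+1 by have [] := fP _ (gA n).
have mA n : measurable (A n) by case: (gA n).
pose B := \bigcup_n A n.
have mB : measurable B by apply: bigcup_measurable => n _.
have cvA := prob_bigcup (P := P) mA AS.
have gB : good B.
  split => //; first by move=> x [n _]; case: (gA n) => _ + _; apply.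
  by apply: cvgr_to_le cvA _; apply: nearW => n; case: (gA n).
exists B; split => //; first by case: gB.
apply/eqP; rewrite eq_le; apply/andP; split; first by case: gB.
rewrite leNgt; apply/negP => Bt.
have [||C [mC CS C0 Ct]] := @atomless_small_set (S `\` B) (t - m B)
  (measurableD mS mB).
- by rewrite probD ?subr_gt0//; [exact: lt_le_trans tS|case: gB].
- by rewrite subr_gt0.
have mBC : m (B `|` C) = m B + m C.
  by apply: probU => //; rewrite -subset0 => x [Bx /CS[]].
have gBC : good (B `|` C).
  split; [exact: measurableU| |].
  - by move=> x [Bx|/CS[]//]; case: gB => _ + _; apply.
  - rewrite mBC; lra.
(* Since [B] together with [C] is admissible and contains every [A n], its mass is at most
   [2 * m (A n.+1) - m (A n)], which tends to [m B]. This contradicts [0 < m C]. *)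
have : m (B `|` C) <= m B.
  have -> : m B = 2 * m B - m B by ring.
  have cvS : m (A n.+1) @[n --> \oo] --> m B by rewrite (cvg_shiftS (fun n => m
    (A n))).
  apply: (@cvgr_to_ge _ \oo _ _ (fun n => 2 * m (A n.+1) - m (A n))).
    by apply: cvgB cvA; exact: cvgMl_tmp cvS.
  apply: nearW => n.
  have [_ _ ->//] := fP _ (gA n); first by move=> x Anx; left; exists n.
rewrite mBC; lra.
Qed.
End atomless_probability.

Lemma measurable_preimage (d d' : measure_display) (T : measurableType d)
  (U : measurableType d') (f : T -> U) (B : set U) :
  measurable_fun setT f -> measurable B -> measurable (f @^-1` B).
Proof. by move=> mf mB; rewrite -[_ @^-1` _]setTI; exact: mf. Qed.

Section tail_split.
Context (d : measure_display) (T : measurableType d) (R : realType)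
  (P : probability T R).
Hypothesis hP : atomless P.
Notation m := (prob P).

(** With [c] a quantile of [X] on [S], the part of [S] where [X > c] has mass at most [t] and the
    part where [X >= c] has mass at least [t]. The missing mass is cut out of the level set [X = c],
    by atomlessness. *)
Lemma tail_split (X : T -> R) (S : set T) (t : R) : measurable_fun setT X ->
  measurable S -> 0 < t -> t < m S ->
  exists c B, [/\ measurable B, B `<=` S, m B = t,
    forall w, B w -> c <= X w & forall w, S w -> ~ B w -> X w <= c].
Proof.
move=> mX mS t0 tS.
pose G x := S `&` X @^-1` `]x, +oo[.
have GE x w : G x w <-> S w /\ x < X w.
  by rewrite /G /= in_itv/= andbT.
have mG x : measurable (G x) by apply: measurableI => //;
  exact: measurable_preimage.
have Gle x y : x <= y -> m (G y) <= m (G x).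
  move=> xy; apply: le_prob => // w /GE[Sw yw]; apply/GE; split => //.
  exact: le_lt_trans yw.
pose E := [set x | m (G x) <= t].
(* The bounds [N] and [M] show that [E] is nonempty and bounded below, so that [inf E] is a genuine
   infimum. *)
have [N hN] : exists n : nat, m (G n%:R) < t.
  have := @prob_bigcap _ _ _ P (fun n => G n%:R) (fun n => mG _).
  have -> : \bigcap_n G n%:R = set0.
    rewrite -subset0 => w /= h.
    have [n Xn] : exists n : nat, X w <= n%:R.
      by exists (Num.truncn (Num.max 0 (X w))).+1;
        rewrite ltW// (le_lt_trans _ (truncnS_gt _))// le_max lexx orbT.
    by have /GE[_] := h n I; rewrite ltNge Xn.
  rewrite prob0 => /(_ _)/cvgrPdist_lt/(_ _ t0) [].
    by move=> n w /GE[Sw nw]; apply/GE; split => //; apply: lt_trans nw;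
      rewrite ltr_nat.
  move=> n _ /(_ n (leqnn n)); rewrite /= sub0r normrN ger0_norm ?prob_ge0//.
  by exists n.
have [M hM] : exists n : nat, t < m (G (- n%:R)).
  have := @prob_bigcup _ _ _ P (fun n => G (- n%:R)) (fun n => mG _).
  have -> : \bigcup_n G (- n%:R) = S.
    apply/seteqP; split => [w [n _ /GE[]//]|w Sw].
    exists (Num.truncn (Num.max 0 (- X w))).+1 => //; apply/GE; split => //.
    by rewrite ltrNl (le_lt_trans _ (truncnS_gt _))// le_max lexx orbT.
  move=> /(_ _)/cvgrPdist_lt/(_ (m S - t)) []; rewrite ?subr_gt0//.
    by move=> n w /GE[Sw nw]; apply/GE; split => //; apply: lt_trans nw;
      rewrite ltrN2 ltr_nat.
  move=> n _ /(_ n (leqnn n)) /=; rewrite ger0_norm; first by exists n; lra.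
  by rewrite subr_ge0; apply: le_prob => // w /GE[].
have infE : has_inf E.
  split; first by exists N%:R; exact: ltW.
  exists (- M%:R) => x Ex; rewrite leNgt; apply/negP => /ltW/Gle.
  by move: Ex; rewrite /E/=; lra.
pose c := inf E.
(* Continuity from below along [c + 1/(n+1)], where the masses are at most [t] because some element
   of [E] lies to the left. *)
have gc : m (G c) <= t.
  have cv := @prob_bigcup _ _ _ P (fun n => G (c + n.+1%:R^-1)) (fun n => mG _).
  have e : \bigcup_n G (c + n.+1%:R^-1) = G c.
    apply/seteqP; split => [w [n _ /GE[Sw h]]|w /GE[Sw h]].
      by apply/GE; split => //; apply: lt_trans h; rewrite ltrDl invr_gt0.
    have h0 : 0 < X w - c by rewrite subr_gt0.
    exists (Num.truncn (X w - c)^-1) => //; apply/GE; split => //.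
    rewrite -ltrBrDl invf_plt ?posrE// ?invr_gt0//.
    exact: truncnS_gt.
  rewrite e in cv; apply: (cvgr_to_le (cv _)).
    move=> n w /GE[Sw nw]; apply/GE; split => //; apply: le_lt_trans nw.
    by rewrite lerD2l lef_pV2 ?posrE// ler_nat.
  apply: nearW => n; have n0 : 0 < n.+1%:R^-1 :> R by rewrite invr_gt0.
  have [x Ex xc] := inf_adherent n0 infE.
  by apply: le_trans Ex; apply/Gle/ltW.
pose H := S `&` X @^-1` `[c, +oo[.
have mH : measurable H by apply: measurableI => //; exact: measurable_preimage.
have HE w : H w <-> S w /\ c <= X w.
  by rewrite /H /= in_itv/= andbT.
(* Continuity from above along [c - 1/(n+1)], a point below the infimum and hence not in [E]. *)
have hc : t <= m H.
  have cv := @prob_bigcap _ _ _ P (fun n => G (c - n.+1%:R^-1)) (fun n => mG _).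
  have e : \bigcap_n G (c - n.+1%:R^-1) = H.
    apply/seteqP; split => [w h|w /HE[Sw h] n _].
      apply/HE; split; first by have /GE[] := h 0%N I.
      rewrite leNgt -subr_gt0; apply/negP => h0.
      have /GE[_] := h (Num.truncn (c - X w)^-1) I; apply/negP; rewrite -leNgt.
      rewrite lerBrDr -lerBrDl ltW// invf_plt ?posrE// ?invr_gt0//.
      exact: truncnS_gt.
    by apply/GE; split => //; apply: lt_le_trans h;
      rewrite ltrBlDr ltrDl invr_gt0.
  rewrite e in cv; apply: (cvgr_to_ge (cv _)).
    move=> n w /GE[Sw nw]; apply/GE; split => //; apply: le_lt_trans nw.
    by rewrite lerD2l lerN2 lef_pV2 ?posrE// ler_nat.
  apply: nearW => n; rewrite leNgt; apply/negP => /ltW h.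
  have : c <= c - n.+1%:R^-1 by apply: ge_inf => //; case: infE.
  by rewrite lerBrDr gerDl leNgt invr_gt0 ltr0n.
have GH : G c `<=` H by move=> w /GE[Sw /ltW ?]; apply/HE.
have mD : measurable (H `\` G c) by exact: measurableD.
have [||D [mD' DS Dt]] := @atomless_intermediate _ _ _ _ hP _ (t - m (G c)) mD.
- by rewrite subr_ge0.
- by rewrite probD// lerD2r.
exists c, (G c `|` D); split.
- exact: measurableU.
- by move=> w [/GE[]//|/DS[/HE[]]].
- rewrite probU// ?Dt; first by rewrite addrC subrK.
  by rewrite -subset0 => w [Gw /DS[]].
- by move=> w [/GE[_ /ltW]//|/DS[/HE[]]].
- move=> w Sw nB; rewrite leNgt; apply/negP => h; apply: nB; left; exact/GE.
Qed.
End tail_split.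

(** * Expected Shortfall as a conditional expectation on tail events *)

Section VaR_quantile.
Context (d : measure_display) (T : measurableType d) (R : realType)
  (P : probability T R) (X : {RV P >-> R}).
Notation m := (prob P).
Notation F x := (m [set w | X w <= x]).

Lemma measurable_le x : measurable [set w | X w <= x].
Proof.
have -> : [set w | X w <= x] = X @^-1` `]-oo, x].
  by apply/seteqP; split => w /=; rewrite in_itv.
exact: measurable_preimage.
Qed.

Lemma measurable_lt x : measurable [set w | X w < x].
Proof.
have -> : [set w | X w < x] = X @^-1` `]-oo, x[.
  by apply/seteqP; split => w /=; rewrite in_itv.
exact: measurable_preimage.
Qed.

Lemma measurable_gt x : measurable [set w | x < X w].
Proof.
have -> : [set w | x < X w] = ~` [set w | X w <= x].
  by apply/seteqP; split => w /=; rewrite ltNge => /negP.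
by apply: measurableC; exact: measurable_le.
Qed.

Lemma prob_gtE x : m [set w | x < X w] = 1 - F x.
Proof.
rewrite -probC; last exact: measurable_le.
by congr prob; apply/seteqP; split => w /=; rewrite ltNge => /negP.
Qed.

Lemma le_cdf x y : x <= y -> F x <= F y.
Proof.
move=> xy; apply: le_prob; [exact: measurable_le|exact: measurable_le|].
by move=> w /= h; exact: le_trans xy.
Qed.

(** Right continuity of the distribution function, in the form used for the infimum in [VaR]. *)
Lemma cdf_nbhs_right x s : (forall y, x < y -> s <= F y) -> s <= F x.
Proof.
move=> h; have cv := @prob_bigcap _ _ _ P (fun n => [set w | X w <= x +
  n.+1%:R^-1])
  (fun n => measurable_le _).
have e : \bigcap_n [set w | X w <= x + n.+1%:R^-1] = [set w | X w <= x].
  apply/seteqP; split => [w /= wn|w /= wx n _ /=].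
    rewrite leNgt -subr_gt0; apply/negP => h0.
    have /= := wn (Num.truncn (X w - x)^-1) I; apply/negP; rewrite -ltNge.
    by rewrite -ltrBrDl invf_plt ?posrE ?invr_gt0// truncnS_gt.
  by apply: le_trans wx _; rewrite lerDl invr_ge0.
rewrite e in cv; apply: (cvgr_to_ge (cv _)).
  by move=> n w /= nw; apply: le_trans nw _; rewrite lerD2l lef_pV2 ?posrE//
    ler_nat.
by apply: nearW => n; apply: h; rewrite ltrDl invr_gt0.
Qed.

Lemma cdf_gt s : s < 1 -> exists x, s < F x.
Proof.
move=> s1; have := @prob_bigcup _ _ _ P (fun n => [set w | X w <= n%:R])
  (fun n => measurable_le _).
have -> : \bigcup_n [set w | X w <= n%:R] = setT.
  apply/seteqP; split => // w _; exists (Num.truncn (Num.max 0 (X w))).+1 =>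
    //=.
  by rewrite ltW// (le_lt_trans _ (truncnS_gt _))// le_max lexx orbT.
rewrite probT => /(_ _)/cvgrPdist_lt/(_ (1 - s)) []; rewrite ?subr_gt0//.
  by move=> n w /= h; apply: le_trans h _; rewrite ler_nat.
move=> n _ /(_ n (leqnn n)) /= /ltr_normlP[? ?]; exists n%:R; lra.
Qed.

(** The Galois relation between quantile and distribution function. The first hypothesis makes [c] a
    lower bound of the set that defines [VaR], [s < 1] makes this set nonempty, and right continuity
    puts the infimum into it. *)
Lemma VaR_le (c s x : R) : m [set w | X w < c] < s -> s < 1 ->
  (VaR P s X <= x) = (s <= F x).
Proof.
move=> cs s1; rewrite /VaR; set E := [set x | _].
have EE y : E y <-> s <= F y.
  by rewrite /E /= probE ?lee_fin//; exact: measurable_le.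
have lbE : lbound E c.
  move=> y /EE sF; rewrite leNgt; apply/negP => yc.
  suff : F y <= m [set w | X w < c] by lra.
  apply: le_prob; [exact: measurable_le|exact: measurable_lt|].
  by move=> w /= h; exact: le_lt_trans yc.
have infE : has_inf E.
  split; last by exists c.
  by have [y sy] := cdf_gt s1; exists y; apply/EE/ltW.
apply/idP/idP => [Ex|sF]; last by apply: ge_inf; [case: infE|apply/EE].
apply: cdf_nbhs_right => y xy.
have yx : 0 < y - inf E by rewrite subr_gt0; exact: le_lt_trans xy.
have [z /EE Ez zy] := inf_adherent yx infE.
by apply: le_trans Ez (le_cdf _); lra.
Qed.

Lemma VaR_ge (c s : R) : m [set w | X w < c] < s -> s < 1 -> c <= VaR P s X.
Proof.
move=> cs s1; rewrite leNgt; apply/negP => h.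
(* The midpoint lies strictly below [c] and is still at least the quantile. *)
have : VaR P s X <= (VaR P s X + c) / 2 by lra.
rewrite (VaR_le _ cs s1) => sF.
suff : F ((VaR P s X + c) / 2) <= m [set w | X w < c] by lra.
apply: le_prob; [exact: measurable_le|exact: measurable_lt|].
by move=> w /=; lra.
Qed.
End VaR_quantile.

Section ES_excess.
Context (d : measure_display) (T : measurableType d) (R : realType)
  (P : probability T R) (X : {RV P >-> R}).
Notation m := (prob P).
Notation F x := (m [set w | X w <= x]).
Notation mu := (@lebesgue_measure R).

(* The hypotheses say that [c] is a [p]-quantile of [X]. Under the uniform law on
   [p, 1], the excess of VaR over [c] has survival function 1/(1-p) times that of
   the positive part of [X - c], so the two expectations agree up to this factor
   by the tail formula. *)
Lemma ES_excess (p c : R) : 0 < p -> p < 1 -> P.-integrable setT (EFin \o X) ->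
  m [set w | X w < c] <= p -> p <= F c ->
  ES P p X = c + (1 - p)^-1 * \int[P]_w Num.max (X w - c) 0.
Proof.
move=> p0 p1 iX pc1 pc2.
have VE s x : s \in `]p, 1[ -> (VaR P s X <= x) = (s <= F x).
  rewrite in_itv/= => /andP[ps s1]; exact: VaR_le (le_lt_trans pc1 ps) s1.
have Vc s : s \in `]p, 1[ -> c <= VaR P s X.
  rewrite in_itv/= => /andP[ps s1]; exact: VaR_ge (le_lt_trans pc1 ps) s1.
pose g : measurableTypeR R -> R := fun s => if s \in `]p, 1[ then VaR P s X - c
  else 0.
have g0 s : 0 <= g s by rewrite /g; case: ifPn => // /Vc; rewrite subr_ge0.
(* By the Galois relation the superlevel sets of [g] are intervals. This yields both the
   measurability of [g] and its survival function under the uniform law. *)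
have gE x : 0 <= x -> g @^-1` `]x, +oo[ = `]F (c + x), 1[%classic.
  move=> x0; have pF : p <= F (c + x) by apply: le_trans pc2 (le_cdf _ _); lra.
  apply/seteqP; split => s /=; rewrite /g !in_itv/= !andbT.
    case: ifPn => [ps|_]; last by rewrite ltNge x0.
    rewrite ltNge lerBlDr [x + c]addrC VE ?in_itv// -ltNge => ->.
    by case/andP: ps.
  move=> /andP[Fs s1]; have ps : p < s by exact: le_lt_trans Fs.
  by rewrite ps s1/= ltNge lerBlDr [x + c]addrC VE ?in_itv/= ?ps// -ltNge.
have mg : measurable_fun setT g.
  move=> _; apply: (measurability _ (RGenOInfty.measurableE R)) => // _ [_ [x
    ->] <-].
  rewrite setTI; have [x0|x0] := leP 0 x; first by rewrite gE.
  rewrite (_ : _ @^-1` _ = setT)//; apply/seteqP; split => // s _ /=.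
  by rewrite in_itv/= andbT (lt_le_trans x0).
pose U := uniform_prob p1.
pose gM := isMeasurableFun.Build _ _ _ _ g mg.
pose G : {RV U >-> R} := HB.pack g gM.
pose h w := Num.max (X w - c) 0.
have mh : measurable_fun setT h.
  by apply: measurable_maxr => //; exact: measurable_funB.
pose hM := isMeasurableFun.Build _ _ _ _ h mh.
pose H : {RV P >-> R} := HB.pack h hM.
have h0 w : 0 <= h w by rewrite /h le_max lexx orbT.
have p10 : 0 < 1 - p by rewrite subr_gt0.
have ccdfE r : 0 <= r -> (ccdf H r = (1 - p)%:E * ccdf G r)%E.
  move=> r0; rewrite /ccdf /distribution /pushforward.
  have -> : (H : T -> R) @^-1` `]r, +oo[ = [set w | c + r < X w].
    apply/seteqP; split => w /=; rewrite in_itv/= andbT /h lt_max.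
      by rewrite [r < 0]ltNge r0 orbF ltrBrDl.
    by move=> ?; rewrite ltrBrDl; apply/orP; left.
  rewrite probE; last exact: measurable_gt.
  rewrite prob_gtE (gE r r0).
  have pF : p <= F (c + r) by apply: le_trans pc2 (le_cdf _ _); lra.
  have F1 : F (c + r) <= 1.
    by rewrite -(probT P); apply: le_prob => //; exact: measurable_le.
  move: (F (c + r)) pF F1 => a pa a1.
  rewrite [X in (_ * X)%E](_ : _ = (\int[mu]_(s in `]a, 1%R[) (uniform_pdf p 1
    s)%:E)%E)//.
  rewrite (eq_integral (cst ((1 - p)^-1)%:E)).
    rewrite integral_cst//= lebesgue_measure_itv/= lte_fin.
    case: ifPn => [F1|]; first by rewrite -EFinB -!EFinM; congr EFin; field;
      lra.
    rewrite -leNgt => ?; rewrite !mule0; congr EFin; lra.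
  move=> s; rewrite inE/= in_itv/= => /andP[Fs s1].
  by rewrite /uniform_pdf (ltW s1) (le_trans pa (ltW Fs)).
have EPU : ('E_P[H] = (1 - p)%:E * 'E_U[G])%E.
  rewrite !ge0_expectation_ccdf// -ge0_integralZl//.
  - apply: eq_integral => r; rewrite inE/= in_itv/= andbT; exact: ccdfE.
  - apply: measurable_funTS; exact: ccdf_measurable.
  - by rewrite lee_fin ltW.
have IV : (\int[mu]_(s in `]p, 1%R[) (VaR P s X - c)%:E = \int[P]_w (h w)%:E)%E.
  transitivity ('E_P[H])%E; last by rewrite expectation_def.
  rewrite EPU expectation_def integral_uniform//.
  (* The factor [1 - p] cancels the uniform density. The uniform law lives on the closed interval,
     but [g] is zero at its endpoints. *)
  - rewrite muleA -EFinM divff ?gt_eqF// mul1e [LHS]integral_mkcond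
    [RHS]integral_mkcond.
    apply: eq_integral => s _; rewrite !patchE !mem_setE /=.
    rewrite /g; case: ifPn => // sp; last by case: ifPn.
    by rewrite ifT//; move: sp; rewrite !in_itv/= => /andP[/ltW-> /ltW->].
  - by apply/measurable_EFinP.
have iH : P.-integrable setT (EFin \o h).
  apply: le_integrable (integrableB measurableT iX
    (finite_measure_integrable_cst P c measurableT)) => //.
    exact/measurable_EFinP.
  move=> w _ /=; rewrite lee_fin (ger0_norm (h0 w)) /h ge_max normr_ge0 andbT.
  exact: ler_norm.
have iV : mu.-integrable `]p, 1[ (EFin \o (fun s => VaR P s X - c)).
  apply/integrableP; split.
    apply/measurable_EFinP; apply: (eq_measurable_fun g).
      by move=> s; rewrite inE/= /g => ->.
    exact: measurable_funTS.
  rewrite [ltLHS](_ : _ = \int[P]_w (h w)%:E)%E.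
    by have /integrableP[_] := iH; under eq_integral do rewrite /= ger0_norm//.
  by rewrite -IV; apply: eq_integral => s; rewrite inE /= => /Vc ?;
    rewrite ger0_norm// subr_ge0.
have -> : ES P p X = (1 - p)^-1 * \int[mu]_(s in `]p, 1[) (c + (VaR P s X - c)).
  by congr (_ * _); apply: eq_Rintegral => s _; rewrite addrC subrK.
rewrite RintegralD//.
  rewrite Rintegral_cst//.
  rewrite [X in fine X](_ : _ = (1 - p)%:E) /=; last first.
    by rewrite (@lebesgue_measure_itv _ `]p, 1[) /= lte_fin p1.
  rewrite [X in _ * (_ + X)]/Rintegral IV.
  by rewrite mulrDr mulrCA mulVf ?mulr1// gt_eqF.
apply/integrableP; split; first exact/measurable_EFinP.
by rewrite /= integral_cst//= lebesgue_measure_itv/= lte_fin p1 -EFinB -EFinM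
  ltry.
Qed.
End ES_excess.

Section tail_expectation.
Context (d : measure_display) (T : measurableType d) (R : realType)
  (P : probability T R).
Notation m := (prob P).

Lemma ae_ex (C : set T) (Q : T -> Prop) : measurable C -> 0 < m C ->
  (\forall w \ae P, Q w) -> exists2 w, C w & Q w.
Proof.
move=> mC C0 [N [mN N0 QN]]; apply: contrapT => h.
have : m C <= m N.
  apply: le_prob => // w Cw; apply: QN => Qw; apply: h; by exists w.
by rewrite [m N]/prob N0 /= leNgt C0.
Qed.

Lemma ae_notin (N : set T) : measurable N -> m N = 0 -> \forall w \ae P, ~ N w.
Proof.
move=> mN N0; exists N; split => //; first by rewrite probE// N0.
by move=> w /= /contrapT.
Qed.

Hypothesis hP : atomless P.
Variables (p : R) (p0 : 0 < p) (p1 : p < 1).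

(** The complement of the upper part [B] has mass [p] and lies between the events [X < c] and
    [X <= c], so the threshold [c] is a [p]-quantile. *)
Lemma tail_quantile (X : {RV P >-> R}) : exists c B, [/\ measurable B, m B = 1
  - p,
    (forall w, B w -> c <= X w) /\ (forall w, ~ B w -> X w <= c),
    m [set w | X w < c] <= p & p <= m [set w | X w <= c]].
Proof.
have [|||c [B [mB _ mBp h1 h2]]] := @tail_split _ _ _ _ hP X setT (1 - p) _
  measurableT.
- by [].
- by rewrite subr_gt0.
- by rewrite probT ltrBlDr ltrDl.
have pC : m (~` B) = p by rewrite probC// mBp; lra.
exists c, B; split => //.
- by split => // w; exact: h2.
- rewrite -pC; apply: le_prob; [exact: measurable_lt|exact: measurableC|].
  by move=> w /= Xc /h1; rewrite leNgt Xc.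
- rewrite -pC; apply: le_prob; [exact: measurableC|exact: measurable_le|].
  by move=> w /= /h2; exact.
Qed.

(** The two differences of [A] and [B] have equal mass. If they are null, [A] inherits the bounds
    from [B]. Otherwise a point of [B] outside [A] has value at least [c] and is dominated by almost
    all of [A], and a point of [A] outside [B] has value at most [c] and dominates almost all of the
    complement of [A]. *)
Lemma tail_event_threshold (X : {RV P >-> R}) (A B : set T) (c : R) :
  p_tail_event P p X A -> measurable B -> m B = 1 - p ->
  (forall w, B w -> c <= X w) -> (forall w, ~ B w -> X w <= c) ->
  (\forall w \ae P, A w -> c <= X w) /\ (\forall w \ae P, ~ A w -> X w <= c).
Proof.
move=> [[mA _ _ AX] PA] mB mBp h1 h2.
have mAp : m A = 1 - p by rewrite /prob PA.
have mAB : measurable (A `\` B) by exact: measurableD.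
have mBA : measurable (B `\` A) by exact: measurableD.
have mE : m (A `\` B) = m (B `\` A).
  have DE C D : m (C `\` D) = m (C `\` (C `&` D)) by rewrite setDIr setDv set0U.
  rewrite DE (DE B) !probD//; try (by move=> w []); try exact: measurableI.
  by rewrite mAp mBp setIC.
have [AB0|AB0] := eqVneq (m (A `\` B)) 0.
  have BA0 : m (B `\` A) = 0 by rewrite -mE.
  split.
    apply: filterS (ae_notin mAB AB0) => w nAB Aw; apply: h1.
    by apply: contrapT => nB; apply: nAB.
  apply: filterS (ae_notin mBA BA0) => w nBA nA; apply: h2 => Bw.
  exact: nBA.
have AB1 : 0 < m (A `\` B) by rewrite lt_neqAle eq_sym AB0 prob_ge0.
split.
  apply: filterS AX => w /[apply].
  rewrite mE in AB1 => /(ae_ex mBA AB1)[w' [Bw' nA] /(_ nA)].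
  by apply: le_trans; exact: h1.
have [w [Aw nBw] /(_ Aw)] := ae_ex mAB AB1 AX.
by apply: filterS => w' /[apply] /le_trans; apply; exact: h2.
Qed.

Lemma integrable_sub (A : set T) (X : T -> R) : measurable A ->
  P.-integrable setT (EFin \o X) -> P.-integrable A (EFin \o X).
Proof. by move=> mA; apply: integrableS. Qed.

Lemma integrable_cstE (A : set T) (c : R) : measurable A ->
  P.-integrable A (EFin \o (fun=> c)).
Proof. exact: finite_measure_integrable_cst. Qed.

Lemma integrable_max (A : set T) (X : T -> R) (c : R) : measurable A ->
  P.-integrable A (EFin \o X) -> P.-integrable A (EFin \o (fun w => Num.max (X
    w) c)).
Proof.
move=> mA iX.
have mX : measurable_fun A X by have /integrableP[/measurable_EFinP] := iX.
apply: le_integrable (integrableD mA (integrable_abse iX)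
    (integrable_abse (finite_measure_integrable_cst P c mA))) => //.
  by apply/measurable_EFinP/measurable_maxr.
move=> w _ /=; rewrite lee_fin.
rewrite [leRHS]ger0_norm ?addr_ge0//; have [_|_] := leP (X w) c.
  by rewrite lerDr.
by rewrite lerDl.
Qed.

Section quantile.
Variables (X : {RV P >-> R}) (c : R).
Hypotheses (iX : P.-integrable setT (EFin \o X))
  (pc1 : m [set w | X w < c] <= p) (pc2 : p <= m [set w | X w <= c]).

Lemma Rintegral_shift (A : set T) (Y : T -> R) : measurable A -> m A = 1 - p ->
  P.-integrable A (EFin \o Y) ->
  (1 - p)^-1 * \int[P]_(w in A) Y w = c + (1 - p)^-1 * \int[P]_(w in A) (Y w -
    c).
Proof.
move=> mA mAp iY; rewrite RintegralB//; last exact: integrable_cstE.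
rewrite Rintegral_cst// -/(prob P A) mAp; field; by rewrite subr_eq0 gt_eqF.
Qed.

(** After subtracting [c], the integrand on [A] is at most the positive part of [X - c], whose
    integral only grows from [A] to the whole space. Both [Y = X] and [Y = max X c] are used
    later. *)
Lemma ES_excess_ge (A : set T) (Y : T -> R) : measurable A -> m A = 1 - p ->
  P.-integrable A (EFin \o Y) -> (forall w, A w -> Y w <= Num.max (X w) c) ->
  (1 - p)^-1 * \int[P]_(w in A) Y w <= ES P p X.
Proof.
move=> mA mAp iY YX.
rewrite (ES_excess p0 p1 iX pc1 pc2) Rintegral_shift// lerD2l ler_pM2l
  ?invr_gt0 ?subr_gt0//.
have iM : P.-integrable setT (EFin \o (fun w => Num.max (X w - c) 0)).
  apply: integrable_max => //.
  exact: (integrableB measurableT iX (integrable_cstE c measurableT)).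
apply: (@le_trans _ _ (\int[P]_(w in A) Num.max (X w - c) 0)).
  apply: le_Rintegral => //.
  - exact: (integrableB mA iY (integrable_cstE c mA)).
  - exact: integrable_sub.
  - by move=> w /YX; rewrite !le_max !lerBlDr subrK add0r.
rewrite Rintegral_mkcond; apply: le_Rintegral => //.
  by rewrite -restrict_EFin; apply/(integrable_mkcond _ mA);
    exact: integrable_sub mA iM.
move=> w _; rewrite patchE; case: ifPn => // _; by rewrite le_max lexx orbT.
Qed.

(** The positive part of [X - c] is almost surely [X - c] on [A] and zero off [A]. *)
Lemma ES_threshold (A : set T) : measurable A -> m A = 1 - p ->
  (\forall w \ae P, A w -> c <= X w) -> (\forall w \ae P, ~ A w -> X w <= c) ->
  ES P p X = (1 - p)^-1 * \int[P]_(w in A) X w.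
Proof.
move=> mA mAp Ac nAc.
rewrite (ES_excess p0 p1 iX pc1 pc2) [RHS]Rintegral_shift//;
  last exact: integrable_sub mA iX.
congr (_ + _ * _); rewrite [RHS]Rintegral_mkcond; congr fine.
have mXc : measurable_fun setT (fun w => X w - c) by exact: measurable_funB.
apply: ae_eq_integral => //.
- by apply/measurable_EFinP/measurable_maxr.
- by apply/measurable_EFinP/measurable_restrict => //; exact: measurable_funTS.
- apply: filterS2 Ac nAc => w h1 h2 _ /=; rewrite patchE; case: ifPn.
    by rewrite inE => /h1 ?; rewrite max_l// subr_ge0.
  by rewrite notin_setE => /h2 ?; rewrite max_r// subr_le0.
Qed.
End quantile.

Lemma ES_ge (X : {RV P >-> R}) (A : set T) : P.-integrable setT (EFin \o X) ->
  measurable A -> m A = 1 - p -> (1 - p)^-1 * \int[P]_(w in A) X w <= ES P p X.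
Proof.
move=> iX mA mAp; have [c [_ [_ _ _ c1 c2]]] := tail_quantile X.
apply: (ES_excess_ge iX c1 c2) => //; first exact: integrable_sub mA iX.
by move=> w _; rewrite le_max lexx.
Qed.

(** Provides integrands bounded below for Fatou's lemma. If [c] is at most the quantile [c'], then
    [max X c] is at most [max X c']; otherwise [c] is itself a [p]-quantile. *)
Lemma ES_ge_max (X : {RV P >-> R}) (c : R) (A : set T) : P.-integrable setT
  (EFin \o X) ->
  m [set w | X w < c] <= p ->
  measurable A -> m A = 1 - p -> (1 - p)^-1 * \int[P]_(w in A) Num.max (X w) c
    <= ES P p X.
Proof.
move=> iX cp mA mAp; have [c' [_ [_ _ _ c1 c2]]] := tail_quantile X.
have iM := integrable_max c mA (integrable_sub mA iX).
have [cc|cc] := leP c c'.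
  apply: (ES_excess_ge iX c1 c2) => // w _.
  by rewrite ge_max !le_max lexx cc orbT.
apply: (ES_excess_ge iX cp) => //.
by apply: le_trans c2 (le_cdf _ _); exact: ltW.
Qed.

Lemma ES_tail (X : {RV P >-> R}) (A : set T) : P.-integrable setT (EFin \o X) ->
  p_tail_event P p X A -> ES P p X = (1 - p)^-1 * \int[P]_(w in A) X w.
Proof.
move=> iX tA; have [c [B [mB mBp [h1 h2] c1 c2]]] := tail_quantile X.
have [t1 t2] := tail_event_threshold tA mB mBp h1 h2.
case: tA => -[mA _ _ _] PA.
by apply: (ES_threshold iX c1 c2) => //; rewrite /prob PA.
Qed.
End tail_expectation.

(** * Expected Shortfall satisfies the axioms *)

Lemma Lfun_integrable_setT (d : measure_display) (T : measurableType d) (R :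
  realType)
  (P : probability T R) (q : R) (hq : (1 <= q%:E)%E) (X : LfunType P hq) :
  P.-integrable setT (EFin \o X).
Proof.
apply/Lfun1_integrable.
exact: (Lfun_subset (lexx _) hq (fin_num_measure P _ measurableT) hq (LfunP X)).
Qed.

Lemma le_limn_einf (R : realType) (u v : (\bar R)^nat) :
  (\forall n \near \oo, (u n <= v n)%E) -> (limn_einf u <= limn_einf v)%E.
Proof.
move=> [N _ uv]; rewrite !limn_einf_lim; apply: lee_lim;
  [exact: is_cvg_einfs|exact: is_cvg_einfs|].
exists N => // n /= Nn; apply: le_ereal_inf_tmp => _ /= [k nk <-].
apply: ge_ereal_inf; exists (u k); first by exists k.
by apply: uv => /=; exact: leq_trans nk.
Qed.

Lemma maxr_lipschitz (R : realType) (a b c : R) :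
  `|Num.max a c - Num.max b c| <= `|a - b|.
Proof.
have h1 := ler_norm (a - b); have h2 := ler_norm (b - a); rewrite distrC in h2.
rewrite ler_norml; have [ac|ac] := leP a c; have [bc|bc] := leP b c;
  by apply/andP; split; lra.
Qed.

Section cdf_limit.
Context (d : measure_display) (T : measurableType d) (R : realType)
  (P : probability T R).
Notation m := (prob P).

Lemma cdf_lt (X : {RV P >-> R}) s : 0 < s -> exists x, m [set w | X w <= x] < s.
Proof.
move=> s0; have := @prob_bigcap _ _ _ P (fun n => [set w | X w <= - n%:R])
  (fun n => measurable_le _ _).
have -> : \bigcap_n [set w | X w <= - n%:R] = set0.
  rewrite -subset0 => w /= h.
  have /= := h (Num.truncn (Num.max 0 (- X w))).+1 I.
  by rewrite leNgt ltrNl (le_lt_trans _ (truncnS_gt _))// le_max lexx orbT.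
rewrite prob0 => /(_ _)/cvgrPdist_lt/(_ _ s0) [].
  by move=> n w /= h; apply: le_trans h _; rewrite lerN2 ler_nat.
move=> n _ /(_ n (leqnn n)) /=; rewrite sub0r normrN ger0_norm ?prob_ge0// => ?.
by exists (- n%:R).
Qed.

(** The events [D k] that [X_ n < c] for some [n >= k] decrease to a subset of [X <= c], so their
    masses eventually drop below [s]. *)
Lemma prob_lt_near (X_ : nat -> {RV P >-> R}) (X : {RV P >-> R}) c s :
  (forall w, X_ n w @[n --> \oo] --> X w) -> m [set w | X w <= c] < s ->
  \forall n \near \oo, m [set w | X_ n w < c] < s.
Proof.
move=> XX ms; pose D k := \bigcup_(n in [set n | (k <= n)%N]) [set w | X_ n w <
  c].
have mD k : measurable (D k).
  by apply: bigcup_measurable => n _; exact: measurable_lt.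
have DS k : D k.+1 `<=` D k by move=> w [n /= kn ?]; exists n => //=;
  exact: ltnW.
have DX : m (\bigcap_k D k) <= m [set w | X w <= c].
  apply: le_prob; [exact: bigcap_measurableType|exact: measurable_le|].
  move=> w h /=; rewrite leNgt -subr_gt0; apply/negP => h0.
  have /cvgrPdist_lt/(_ _ h0) [N _ hN] := XX w.
  have [n /= /hN/= Nn Xc] := h N I.
  move: Nn; rewrite ltNge => /negP; apply; apply: le_trans (ler_norm _).
  by rewrite lerB// ltW.
have s0 : 0 < s - m (\bigcap_k D k) by rewrite subr_gt0; exact: le_lt_trans ms.
have /cvgrPdist_lt/(_ _ s0) [N _ hN] := @prob_bigcap _ _ _ P D mD DS.
exists N => // n Nn /=; apply: (@le_lt_trans _ _ (m (D n))).
  apply: le_prob => //; first exact: measurable_lt.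
  by move=> w ?; exists n => /=.
by have := hN n Nn; rewrite distrC => /(le_lt_trans (ler_norm _)); lra.
Qed.
End cdf_limit.

Section ES_properties.
Context (d : measure_display) (T : measurableType d) (R : realType)
  (P : probability T R) (hP : atomless P)
  (p : R) (hp0 : 0 < p) (hp1 : p < 1)
  (q : R) (hq : (1 <= q%:E)%E).
Notation m := (prob P).
Implicit Types X Y : LfunType P hq.

Lemma ES_attained X : exists A,
  [/\ measurable A, m A = 1 - p & ES P p X = (1 - p)^-1 * \int[P]_(w in A) X w].
Proof.
have [c [A [mA mAp [h1 h2] c1 c2]]] := tail_quantile hP hp0 hp1 X.
exists A; split => //; apply: (ES_threshold hp0 hp1 _ c1 c2) => //.
- exact: Lfun_integrable_setT.
- exact: aeW.
- exact: aeW.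
Qed.

Lemma ES_le X Y : (forall w, X w <= Y w) -> ES P p X <= ES P p Y.
Proof.
move=> XY; have [A [mA mAp ->]] := ES_attained X.
apply: le_trans (ES_ge hP hp0 hp1 (Lfun_integrable_setT Y) mA mAp).
rewrite ler_pM2l ?invr_gt0 ?subr_gt0//; apply: le_Rintegral => //.
- exact: integrable_sub mA (Lfun_integrable_setT X).
- exact: integrable_sub mA (Lfun_integrable_setT Y).
Qed.

Lemma tail_mean_add X Y A : measurable A ->
  (1 - p)^-1 * \int[P]_(w in A) (X + Y) w =
  (1 - p)^-1 * \int[P]_(w in A) X w + (1 - p)^-1 * \int[P]_(w in A) Y w.
Proof.
move=> mA; rewrite -mulrDr -RintegralD//.
- exact: integrable_sub mA (Lfun_integrable_setT X).
- exact: integrable_sub mA (Lfun_integrable_setT Y).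
Qed.

Lemma tail_mean_cst (c : R) A : measurable A -> m A = 1 - p ->
  (1 - p)^-1 * \int[P]_(w in A) c = c.
Proof.
move=> mA mAp; rewrite Rintegral_cst// -/(prob P A) mAp mulrCA mulVf ?mulr1//.
by rewrite subr_eq0 gt_eqF.
Qed.

Lemma ES_translation X c : ES P p (X + Lcst P hq c) = ES P p X + c.
Proof.
apply/eqP; rewrite eq_le; apply/andP; split.
  have [A [mA mAp ->]] := ES_attained (X + Lcst P hq c).
  rewrite tail_mean_add// tail_mean_cst// lerD2r.
  exact: ES_ge (Lfun_integrable_setT X) mA mAp.
have [A [mA mAp ->]] := ES_attained X.
have := tail_mean_add X (Lcst P hq c) mA; rewrite (tail_mean_cst c)// => <-.
exact: ES_ge (Lfun_integrable_setT _) mA mAp.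
Qed.

Lemma ES0 : ES P p (0 : LfunType P hq) = 0.
Proof.
by have [A [mA mAp ->]] := ES_attained 0; rewrite tail_mean_cst.
Qed.

Lemma ES_law X Y : equal_in_law P X Y -> ES P p X = ES P p Y.
Proof.
move=> XY; congr (_ * _); apply: eq_Rintegral => s _.
rewrite /VaR; congr inf; apply/seteqP.
suff E x : P [set w | X w <= x] = P [set w | Y w <= x] by split => x /=;
  rewrite E.
have := XY `]-oo, x]%classic (measurable_itv _);
  rewrite /distribution /pushforward.
congr (_ = _); congr (P _); apply/seteqP; split => w /=; by rewrite in_itv.
Qed.

(** Subadditivity and law invariance bound the left side by the sum for [X'] and [Y']. Both are
    means over the common tail event, where they add up to a mean of [X' + Y']. *)
Lemma ES_concentration_aversion X Y X' Y' : p_concentrated P p X' Y' ->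
  equal_in_law P X X' -> equal_in_law P Y Y' -> ES P p (X + Y) <= ES P p (X' +
    Y').
Proof.
move=> [A [tX tY]] /ES_law EX /ES_law EY.
apply: (@le_trans _ _ (ES P p X + ES P p Y)).
  have [B [mB mBp ->]] := ES_attained (X + Y).
  rewrite tail_mean_add//; apply: lerD; exact: ES_ge (Lfun_integrable_setT _)
    mB mBp.
rewrite EX EY (ES_tail hP hp0 hp1 _ tX); last exact: Lfun_integrable_setT.
rewrite (ES_tail hP hp0 hp1 _ tY); last exact: Lfun_integrable_setT.
case: tX => -[mA _ _ _] PA; rewrite -tail_mean_add//.
apply: ES_ge (Lfun_integrable_setT _) mA _ => //.
by rewrite /prob PA.
Qed.

Lemma ES_lower_semicontinuous (X_ : nat -> LfunType P hq) X :
  (forall w, X_ n w @[n --> \oo] --> X w) ->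
  ((ES P p X)%:E <= limn_einf (fun n => (ES P p (X_ n))%:E))%E.
Proof.
(* A level [c] below the [p]-quantile of [X]. For large [n] the event [X_ n < c] also has mass below
   [p], so [ES_ge_max] allows [X_ n] to be cut off at [c]. *)
move=> XX; have [c cp] := cdf_lt (P := P) X hp0.
have near_c := prob_lt_near (P := P) XX cp.
have [A [mA mAp ->]] := ES_attained X.
have iX := integrable_sub mA (Lfun_integrable_setT X).
have iXn n := integrable_sub mA (Lfun_integrable_setT (X_ n)).
pose f n w : R := (1 - p)^-1 * (Num.max (X_ n w) c - c).
pose f0 w : R := (1 - p)^-1 * (Num.max (X w) c - c).
have p10 : 0 < (1 - p)^-1 by rewrite invr_gt0 subr_gt0.
have iM (Y : T -> R) : P.-integrable A (EFin \o Y) ->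
    P.-integrable A (EFin \o (fun w => Num.max (Y w) c - c)).
  move=> iY; exact: (integrableB mA (integrable_max c mA iY) (integrable_cstE P
    c mA)).
have E (Y : T -> R) : P.-integrable A (EFin \o Y) ->
    c + \int[P]_(w in A) ((1 - p)^-1 * (Num.max (Y w) c - c)) =
    (1 - p)^-1 * \int[P]_(w in A) Num.max (Y w) c.
  move=> iY; rewrite RintegralZl//; last exact: iM.
  rewrite -(Rintegral_shift hp1 c mA mAp)//; exact: integrable_max.
have iF (Y : T -> R) : P.-integrable A (EFin \o Y) ->
    (\int[P]_(w in A) ((1 - p)^-1 * (Num.max (Y w) c - c))%:E)%E =
    (\int[P]_(w in A) ((1 - p)^-1 * (Num.max (Y w) c - c)))%:E.
  move=> iY; rewrite /Rintegral fineK//; apply: integrable_fin_num => //.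
  exact: (integrableZl mA _ (iM _ iY)).
apply: (@le_trans _ _ (c%:E + \int[P]_(w in A) (f0 w)%:E)%E).
  rewrite /f0 iF// -EFinD E// lee_fin ler_pM2l//.
  apply: le_Rintegral => //; first exact: integrable_max.
  by move=> w _; rewrite le_max lexx.
apply: (@le_trans _ _ (limn_einf (fun n => c%:E + \int[P]_(w in A) (f n
  w)%:E)%E)).
  rewrite limn_einf_shift// leeD2l//.
  apply: le_trans (fatou P mA _ _); first last.
  - by move=> n w _; rewrite lee_fin /f; apply: mulr_ge0;
    rewrite ?subr_ge0 ?le_max ?lexx ?orbT// ltW.
  - by move=> n; have /integrableP[] := integrableZl mA (1 - p)^-1 (iM _ (iXn
    n)).
  rewrite le_eqVlt; apply/orP; left; apply/eqP; apply: eq_integral => w _.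
  suff /cvg_limn_einf_sup[-> _] : (f n w)%:E @[n --> \oo] --> (f0 w)%:E by [].
  apply/fine_cvgP; split; first exact: nearW.
  apply: cvgMl_tmp; apply: cvgB; last exact: cvg_cst.
  apply/cvgrPdist_le => e e0; have /cvgrPdist_le/(_ _ e0) := XX w.
  by apply: filterS => n; apply: le_trans; exact: maxr_lipschitz.
apply: le_limn_einf; apply: filterS near_c => n nc.
rewrite iF// -EFinD E// lee_fin; apply: ES_ge_max => //; last exact: ltW.
exact: Lfun_integrable_setT.
Qed.
End ES_properties.

(** * Risk measures averse to concentration *)

Section bounded_measurable.
Context (d : measure_display) (T : measurableType d) (R : realType).
Implicit Types (f g : T -> R) (S : set T).

Definition bounded_mfun f := measurable_fun setT f /\ exists K, forall w, `|f
  w| <= K.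

Definition splice S f g : T -> R := fun w => if w \in S then f w else g w.

Lemma splice_in S f g w : S w -> splice S f g w = f w.
Proof. by move=> Sw; rewrite /splice mem_set. Qed.

Lemma splice_notin S f g w : ~ S w -> splice S f g w = g w.
Proof. by move=> Sw; rewrite /splice memNset. Qed.

Lemma bounded_mfun_cst (c : R) : bounded_mfun (fun=> c).
Proof. by split => //; exists `|c|. Qed.

Lemma bounded_mfunZ (c : R) f : bounded_mfun f -> bounded_mfun (fun w => c * f
  w).
Proof.
move=> [mf [K hK]]; split; first exact: measurable_funM.
by exists (`|c| * K) => w; rewrite normrM ler_wpM2l.
Qed.

Lemma bounded_mfun_splice S f g : measurable S -> bounded_mfun f ->
  bounded_mfun g ->
  bounded_mfun (splice S f g).
Proof.
move=> mS [mf [K hK]] [mg [L hL]]; split.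
  have -> : splice S f g = (fun w => f w * \1_S w + g w * \1_(~` S) w).
    apply/funext => w; rewrite /splice !indicE in_setC.
    by case: (w \in S); rewrite /= ?mulr1 ?mulr0 ?addr0 ?add0r.
  apply: measurable_funD; apply: measurable_funM => //;
    apply: measurable_indic => //.
  exact: measurableC.
exists (Num.max K L) => w; rewrite le_max /splice; case: ifP => _.
  by rewrite hK.
by rewrite hL orbT.
Qed.

Variables (P : probability T R) (q : R) (hq : (1 <= q%:E)%E).

Lemma bounded_mfun_Lfun f : bounded_mfun f -> f \in Lfun P q%:E.
Proof.
move=> [mf [K hK]]; rewrite inE; apply/andP; split; rewrite inE//=.
rewrite /finite_norm unlock poweR_lty//.
have q0 : 0 <= q by rewrite -lee_fin; exact: le_trans lee01 hq.
apply: (@le_lt_trans _ _ (\int[P]_x (cst (K `^ q)%:E x))%E).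
  apply: ge0_le_integral => //.
  - by move=> w _; rewrite poweR_ge0.
  - apply/measurable_EFinP; apply: (measurableT_comp (measurable_powR q)).
    exact: measurableT_comp.
  - move=> w _ /=; rewrite lee_fin; apply: ge0_ler_powR; rewrite ?nnegrE//.
    exact: le_trans (hK w).
rewrite integral_cst//; apply: lte_mul_pinfty; rewrite ?lee_fin ?powR_ge0//.
by rewrite ltey_eq fin_num_measure.
Qed.
End bounded_measurable.

Section equal_laws.
Context (d : measure_display) (T : measurableType d) (R : realType)
  (P : probability T R).
Notation m := (prob P).
Implicit Types (f g : T -> R) (S B C E : set T).

(** When [m B = m C], the last summand is symmetric in [u] and [v]; hence exchanging the two values
    preserves the law. *)
Lemma prob_preimage_split f B C (u v : R) (E : set R) :
  measurable_fun setT f -> measurable B -> measurable C -> measurable E ->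
  B `&` C = set0 ->
  (forall w, B w -> f w = u) -> (forall w, C w -> f w = v) ->
  m (f @^-1` E) = m (f @^-1` E `\` (B `|` C)) +
                  ((u \in E)%:R * m B + (v \in E)%:R * m C).
Proof.
move=> mf mB mC mE BC fB fC.
have mfE : measurable (f @^-1` E) by exact: measurable_preimage.
have H D w0 : measurable D -> (forall w, D w -> f w = w0) ->
    m (f @^-1` E `&` D) = (w0 \in E)%:R * m D.
  move=> mD fD; have [w0E|w0E] := boolP (w0 \in E).
    rewrite mul1r; congr prob; apply/seteqP; split => [w []//|w Dw];
      split => //=.
    by rewrite fD//; rewrite inE in w0E.
  rewrite mul0r (_ : _ `&` _ = set0) ?prob0// -subset0 => w [/= fw Dw].
  by move/negP: w0E; apply; rewrite -(fD w Dw) inE.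
have mBC : measurable (B `|` C) by exact: measurableU.
rewrite -(H B u mB fB) -(H C v mC fC).
rewrite -probU; try exact: measurableI; last first.
  by rewrite setIACA setIid BC setI0.
rewrite -setIUr -probU.
- by congr prob; rewrite setUC setUIDK.
- exact: measurableD.
- exact: measurableI.
- by rewrite -subset0 => w [[_ nBC] [_]].
Qed.

Lemma prob_preimage_ae f g (N : set T) (E : set R) :
  measurable_fun setT f -> measurable_fun setT g -> measurable E ->
  measurable N -> m N = 0 ->
  (forall w, ~ N w -> f w = g w) -> m (f @^-1` E) = m (g @^-1` E).
Proof.
move=> mf mg mE mN N0 fg.
have H h : measurable_fun setT h -> m (h @^-1` E) = m (h @^-1` E `\` N).
  move=> mh; have mhE : measurable (h @^-1` E) by exact: measurable_preimage.
  have mI : measurable (h @^-1` E `&` N) by exact: measurableI.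
  have mD : measurable (h @^-1` E `\` N) by exact: measurableD.
  have I0 : m (h @^-1` E `&` N) = 0.
    apply/eqP; rewrite eq_le prob_ge0 andbT -N0; exact: le_prob.
  rewrite -[LHS](congr1 m (setUIDK _ N)) probU// ?I0 ?add0r//.
  by rewrite -subset0 => w [[_ Nw] [_]].
rewrite H// (H g)//; congr prob; apply/seteqP; split => w [/= + nN];
  by rewrite fg.
Qed.
End equal_laws.

(** * Dyadic step functions and shrinking sets *)

Section dyadic.
Context (d : measure_display) (T : measurableType d) (R : realType)
  (P : probability T R).
Notation m := (prob P).

(* [f] takes values at least [b] on [S], and is constant on the leaves of a
   binary tree of depth [n] which halves the probability of [S] at each node; [v]
   is the mean of [f] over [S]. Nothing is required of [f] outside [S]. *)
Fixpoint dyadic_step (b : R) (n : nat) (S : set T) (f : T -> R) (v : R) : Prop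
  :=
  match n with
  | 0 => b <= v /\ forall w, S w -> f w = v
  | n.+1 => exists S0 S1 v0 v1,
      [/\ measurable S0, measurable S1, S = S0 `|` S1, S0 `&` S1 = set0 & m S0
        = m S1] /\
      [/\ dyadic_step b n S0 f v0, dyadic_step b n S1 f v1 & v = (v0 + v1) / 2]
  end.

Lemma dyadic_step_ge b n S f v : dyadic_step b n S f v -> b <= v.
Proof.
elim: n S v => [|n IH] S v /=; first by case.
move=> [S0 [S1 [v0 [v1 [_ [/IH h0 /IH h1 ->]]]]]]; lra.
Qed.

Lemma dyadic_step_ge_in b n S f v w : dyadic_step b n S f v -> S w -> b <= f w.
Proof.
elim: n S v => [|n IH] S v /=; first by move=> [bv h] /h ->.
by move=> [S0 [S1 [v0 [v1 [[_ _ -> _ _] [h0 h1 _]]]]]] [/(IH _ _ h0)|/(IH _ _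
  h1)].
Qed.

Lemma dyadic_step_eq b n S f g v : (forall w, S w -> f w = g w) ->
  dyadic_step b n S f v -> dyadic_step b n S g v.
Proof.
elim: n S v => [|n IH] S v fg /=.
  by move=> [bv h]; split => // w Sw; rewrite -fg// h.
move=> [S0 [S1 [v0 [v1 [[mS0 mS1 SE S01 m01] [h0 h1 ve]]]]]].
exists S0, S1, v0, v1; split => //; split => //.
  by apply: IH h0 => w Sw; apply: fg; rewrite SE; left.
by apply: IH h1 => w Sw; apply: fg; rewrite SE; right.
Qed.

Hypothesis hP : atomless P.

(** Split [S] by [tail_split] into halves on which [X] ranges in [[c, hi]] and [[lo, c]]. The two
    ranges add up to [hi - lo], so averaging the gaps of the halves gains a factor 1/2 per level. *)
Lemma dyadic_step_sandwich (X : T -> R) b n S lo hi : measurable_fun setT X ->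
  measurable S -> 0 < m S -> b <= lo -> lo <= hi ->
  (forall w, S w -> lo <= X w <= hi) ->
  exists L U vL vU, [/\ bounded_mfun L, bounded_mfun U,
    dyadic_step b n S L vL, dyadic_step b n S U vU &
    (forall w, S w -> L w <= X w <= U w) /\ vU - vL = 2^-1 ^+ n * (hi - lo)].
Proof.
move=> mX; elim: n S lo hi => [|n IH] S lo hi mS S0 blo lohi XS.
  exists (fun=> lo), (fun=> hi), lo, hi; split; try exact: bounded_mfun_cst.
  - by split.
  - by split => //; exact: le_trans lohi.
  - by rewrite expr0 mul1r.
have [||c [B [mB BS mBS Bc nBc]]] := @tail_split _ _ _ _ hP X S (m S / 2) mX
  mS; try lra.
have mD : measurable (S `\` B) by exact: measurableD.
have mDS : m (S `\` B) = m S / 2 by rewrite probD// mBS; lra.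
have [w1 Bw1] : exists w, B w by apply: (@prob_gt0_ex _ _ _ P); lra.
have [w2 [Sw2 nBw2]] : exists w, (S `\` B) w by apply: (@prob_gt0_ex _ _ _ P);
  lra.
have c1 : c <= hi by apply: le_trans (Bc _ Bw1) _;
  have /andP[] := XS _ (BS _ Bw1).
have c2 : lo <= c.
  by apply: le_trans (nBc _ Sw2 nBw2); have /andP[] := XS _ Sw2.
have [||||L0 [U0 [l0 [u0 [bL0 bU0 dL0 dU0 [LU0 e0]]]]]] := IH B c hi mB;
  try lra.
  by move=> w Bw; rewrite Bc//=; have /andP[] := XS _ (BS _ Bw).
have [||||L1 [U1 [l1 [u1 [bL1 bU1 dL1 dU1 [LU1 e1]]]]]] := IH (S `\` B) lo c
  mD; try lra.
  by move=> w [Sw nB]; rewrite (nBc w)// andbT; have /andP[] := XS _ Sw.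
exists (splice B L0 L1), (splice B U0 U1), ((l0 + l1) / 2), ((u0 + u1) / 2).
have D f0 f1 v0 v1 : dyadic_step b n B f0 v0 -> dyadic_step b n (S `\` B) f1 v1
  ->
    dyadic_step b n.+1 S (splice B f0 f1) ((v0 + v1) / 2).
  move=> h0 h1; exists B, (S `\` B), v0, v1; split; split => //.
  - by rewrite setDUK.
  - by rewrite setDIK.
  - by rewrite mBS.
  - by apply: dyadic_step_eq h0 => w Bw; rewrite splice_in.
  - by apply: dyadic_step_eq h1 => w [_ nB]; rewrite splice_notin.
split; try exact: bounded_mfun_splice; try exact: D; split.
  move=> w Sw; have [Bw|nB] := pselect (B w).
    by rewrite !splice_in//; exact: LU0.
  by rewrite !splice_notin//; exact: LU1.
by rewrite exprS; lra.
Qed.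
Lemma halving_sets S : measurable S -> exists B_ : nat -> set T,
  [/\ forall n, measurable (B_ n), B_ 0%N = S, forall n, B_ n.+1 `<=` B_ n &
      forall n, m (B_ n) = 2^-1 ^+ n * m S].
Proof.
move=> mS; have /choice[h hP'] : forall A, exists B, measurable A ->
    [/\ measurable B, B `<=` A & m B = 2^-1 * m A].
  move=> A; have [mA|?] := pselect (measurable A); last by exists A.
  have [||B ?] := @atomless_intermediate _ _ _ _ hP A (2^-1 * m A) mA.
  - by rewrite mulr_ge0// prob_ge0.
  - by have := prob_ge0 P A; lra.
  - by exists B.
have mh n : measurable (iter n h S) by elim: n => //= n /hP'[].
exists (fun n => iter n h S); split => //.
- by move=> n; have [] := hP' _ (mh n).
- elim=> [|n IH]; first by rewrite expr0 mul1r.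
  by have [_ _ /= ->] := hP' _ (mh n); rewrite IH exprS mulrA.
Qed.

(** The null intersection [N] is removed so that every point, and not just almost every one, leaves
    the sets: lower semicontinuity asks for pointwise convergence. *)
Lemma vanishing_halving_sets S : measurable S -> exists N (C_ : nat -> set T),
  [/\ measurable N, m N = 0,
   C_ 0%N = S `\` N, forall n, measurable (C_ n) /\ C_ n.+1 `<=` C_ n &
   (forall n, m (C_ n) = 2^-1 ^+ n * m S) /\
   forall w, \forall n \near \oo, ~ C_ n w].
Proof.
move=> mS; have [B_ [mB B0 BS Bm]] := halving_sets mS.
pose N := \bigcap_n B_ n.
have mN : measurable N by exact: bigcap_measurableType.
have N0 : m N = 0.
  apply: cvg_unique (@prob_bigcap _ _ _ P B_ mB BS) _ => //.
  rewrite (_ : (fun n => m (B_ n)) = (fun n => 2^-1 ^+ n * m S));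
    last exact/funext.
  rewrite -[0](mul0r (m S)); apply: cvgMr_tmp; apply: cvg_expr.
  by rewrite ger0_norm//; lra.
have NB n : N `<=` B_ n by move=> w; apply.
exists N, (fun n => B_ n `\` N); split => //.
- by rewrite B0.
- by move=> n; split; [exact: measurableD|move=> w [/BS ? ?]].
split; first by move=> n; rewrite probD// N0 subr0.
move=> w; have [Nw|nN] := pselect (N w); first by apply: nearW => n [].
have [k nk] : exists k, ~ B_ k w.
  by apply: contrapT => h; apply: nN => k _; apply: contrapT => ?; apply: h;
    exists k.
exists k => // n /= kn [Bn _]; apply: nk; rewrite -(subnK kn) in Bn.
elim: (n - k)%N Bn => // j IH /BS; exact: IH.
Qed.
End dyadic.

(** * Swapping, averaging and passing to the limit *)

Section concentration_averse.
Context (d : measure_display) (T : measurableType d) (R : realType)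
  (P : probability T R) (hP : atomless P)
  (p : R) (p0 : 0 < p) (p1 : p < 1) (q : R) (hq : (1 <= q%:E)%E)
  (rho : LfunType P hq -> R).
Hypotheses (rhoM : monotonicity rho) (rhoTI : translation_invariance rho)
  (rhoP : lower_semicontinuity rho) (rhoCA : p_concentration_aversion p rho)
  (rho0 : rho 0 = 0).
Notation m := (prob P).
Implicit Types (f g : T -> R) (A B C S : set T).

(* Total on all functions: the value is [rho 0] outside [L^q]. *)
Definition rho_fun f := rho (insubd (0 : LfunType P hq) f).
Notation r := rho_fun.

Lemma rho_funE (X : LfunType P hq) f : X =1 f -> r f = rho X.
Proof. by move=> /funext <-; rewrite /rho_fun valKd. Qed.

Lemma rho_fun_bounded f : bounded_mfun f ->
  exists X : LfunType P hq, (X : T -> R) = f /\ r f = rho X.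
Proof.
move=> bf; exists (Lfun_Sub hq (bounded_mfun_Lfun P hq bf)); split => //.
exact: rho_funE.
Qed.

Lemma rho_fun_le f g : bounded_mfun f -> bounded_mfun g ->
  (forall w, f w <= g w) -> r f <= r g.
Proof.
move=> /rho_fun_bounded[X [<- ->]] /rho_fun_bounded[Y [<- ->]]; exact: rhoM.
Qed.

Lemma rho_fun_cst (c : R) : r (fun=> c) = c.
Proof.
by have := rhoTI 0 c; rewrite rho0 !add0r => rc; rewrite -[RHS]rc;
  exact: rho_funE.
Qed.

(** A pointwise form of tail event with an explicit threshold. Two functions split by the same [A]
    are concentrated even if their thresholds differ. *)
Definition split_at A (b : R) f :=
  (forall w, A w -> b <= f w) /\ (forall w, ~ A w -> f w <= b).

Definition same_law f g :=
  forall E : set R, measurable E -> m (f @^-1` E) = m (g @^-1` E).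

Lemma split_at_p_tail_event A b (X : LfunType P hq) : measurable A -> m A = 1 -
  p ->
  split_at A b X -> p_tail_event P p X A.
Proof.
move=> mA mAp [h1 h2]; split; last by rewrite probE// mAp.
split => //; rewrite ?probE// ?lte_fin ?mAp ?subr_gt0 ?ltrBlDr ?ltrDl//.
apply: aeW => w Aw; apply: aeW => w' nA; exact: le_trans (h2 _ nA) (h1 _ Aw).
Qed.

Lemma same_law_equal_in_law (X Y : LfunType P hq) : same_law X Y ->
  equal_in_law P X Y.
Proof.
move=> XY E mE; rewrite /distribution /pushforward !probE ?XY//;
  exact: measurable_preimage.
Qed.

Lemma rho_fun_aversion f g f' g' A b b' : bounded_mfun f -> bounded_mfun g ->
  bounded_mfun f' -> bounded_mfun g' -> measurable A -> m A = 1 - p ->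
  split_at A b f' -> split_at A b' g' -> same_law f f' -> same_law g g' ->
  r (fun w => f w + g w) <= r (fun w => f' w + g' w).
Proof.
move=> /rho_fun_bounded[X [<- _]] /rho_fun_bounded[Y [<- _]].
move=> /rho_fun_bounded[X' [<- _]] /rho_fun_bounded[Y' [<- _]] mA mAp cX cY XX
  YY.
rewrite (@rho_funE (X + Y))// (@rho_funE (X' + Y'))//.
apply: rhoCA; [|exact: same_law_equal_in_law|exact: same_law_equal_in_law].
by exists A; split; [exact: split_at_p_tail_event cX|exact:
  split_at_p_tail_event cY].
Qed.

(** Aversion applied to the pairs [(f, 0)] and [(g, 0)]: the zero function is split at 0 by any
    set. *)
Lemma rho_fun_law f g A b : bounded_mfun f -> bounded_mfun g ->
  measurable A -> m A = 1 - p -> split_at A b g -> same_law f g -> r f <= r g.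
Proof.
move=> bf bg mA mAp cg fg.
have H h : r h = r (fun w => h w + (fun=> 0) w) by congr r; apply/funext => w;
  rewrite addr0.
rewrite (H f) (H g); have b0 := bounded_mfun_cst T (0 : R).
by apply: (@rho_fun_aversion _ _ _ _ A b 0) => //; split.
Qed.

Lemma rho_fun_lsc (f_ : nat -> T -> R) f (c : R) : (forall n, bounded_mfun (f_
  n)) ->
  bounded_mfun f -> (forall w, f_ n w @[n --> \oo] --> f w) ->
  (forall n, r (f_ n) = c) -> r f <= c.
Proof.
move=> bf_ /rho_fun_bounded[X [<- ->]] cv rc.
have /choice[X_ hX] : forall n, exists X : LfunType P hq, (X : T -> R) = f_ n
  /\ r (f_ n) = rho X.
  by move=> n; exact: rho_fun_bounded.
have := @rhoP X_ X; have -> : (fun n => (rho (X_ n))%:E) = cst c%:E.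
  by apply/funext => n; have [_ <-] := hX n; rewrite rc.
rewrite (cvg_limn_einf_sup (@cvg_cst _ c%:E _ _ _)) lee_fin; apply => w.
rewrite (_ : (fun n => X_ n w) = f_^~ w); first exact: cv.
by apply/funext => n; rewrite (hX n).1.
Qed.

(* Write [f] as [f/2 + f/2] and replace the second summand by [g/2]: both pairs
   are concentrated on [A], so aversion to concentration holds in both
   directions. *)
Lemma rho_fun_midpoint f g A b : bounded_mfun f -> bounded_mfun g ->
  measurable A -> m A = 1 - p -> split_at A b f -> split_at A b g -> same_law f
    g ->
  r f = r (fun w => (f w + g w) / 2).
Proof.
move=> bf bg mA mAp cf cg fg.
have ch h : split_at A b h -> split_at A (2^-1 * b) (fun w => 2^-1 * h w).
  by move=> [h1 h2]; split => w ?; rewrite ler_pM2l// ?h1// h2.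
have fg2 : same_law (fun w => 2^-1 * f w) (fun w => 2^-1 * g w).
  move=> E mE; have mE' : measurable ((fun x : R => 2^-1 * x) @^-1` E).
    by apply: measurable_preimage => //; exact: measurable_funM.
  exact: (fg _ mE').
have -> : f = (fun w => 2^-1 * f w + 2^-1 * f w) by apply/funext => w; lra.
have -> : (fun w => ((2^-1 * f w + 2^-1 * f w) + g w) / 2) =
          (fun w => 2^-1 * f w + 2^-1 * g w) by apply/funext => w; lra.
have bf2 := bounded_mfunZ 2^-1 bf; have bg2 := bounded_mfunZ 2^-1 bg;
  have cf2 := ch f cf; have cg2 := ch g cg.
apply/eqP; rewrite eq_le; apply/andP; split.
  exact: (rho_fun_aversion bf2 bf2 bf2 bg2 mA mAp cf2 cg2).
apply: (rho_fun_aversion bf2 bg2 bf2 bf2 mA mAp cf2 cf2) => // E mE.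
by rewrite fg2.
Qed.

(** [g] is the midpoint of [f] and the function [f'] in which [u] and [v] trade places. The two
    threshold conditions keep [f'] split at [b]; they treat uniformly the cases that [B] and [C]
    both lie in [A] or both lie outside. *)
Lemma rho_fun_merge A b B C (u v : R) f g : bounded_mfun f -> bounded_mfun g ->
  measurable A -> m A = 1 - p -> split_at A b f ->
  measurable B -> measurable C -> B `&` C = set0 -> m B = m C ->
  (forall w, B w -> f w = u) -> (forall w, C w -> f w = v) ->
  (forall w, B w \/ C w -> A w -> b <= u /\ b <= v) ->
  (forall w, B w \/ C w -> ~ A w -> u <= b /\ v <= b) ->
  (forall w, B w \/ C w -> g w = (u + v) / 2) ->
  (forall w, ~ (B w \/ C w) -> g w = f w) ->
  r f = r g.
Proof.
move=> bf bg mA mAp cf mB mC BC mBC fB fC h1 h2 gBC gf.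
pose f' := splice B (fun=> v) (splice C (fun=> u) f).
have f'B w : B w -> f' w = v by move=> Bw; rewrite /f' splice_in.
have f'C w : C w -> f' w = u.
  move=> Cw; rewrite /f' splice_notin ?splice_in// => Bw.
  have : (B `&` C) w by []. by rewrite BC.
have f'n w : ~ (B w \/ C w) -> f' w = f w.
  by move=> n; rewrite /f' !splice_notin// => ?; apply: n; [right|left].
have bf' : bounded_mfun f'.
  by do 2 (apply: bounded_mfun_splice => //; first exact: bounded_mfun_cst).
have -> : g = (fun w => (f w + f' w) / 2).
  apply/funext => w; have [Bw|nB] := pselect (B w).
    by rewrite gBC ?fB ?f'B//; left.
  have [Cw|nC] := pselect (C w); first by rewrite gBC ?fC ?f'C//;
    [rewrite addrC|right].
  have n : ~ (B w \/ C w) by case.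
  rewrite gf// f'n//; lra.
apply: (rho_fun_midpoint bf bf' mA mAp cf).
  split => w Aw; have [Bw|nB] := pselect (B w).
  - by rewrite f'B//; have [] := h1 w (or_introl Bw) Aw.
  - have [Cw|nC] := pselect (C w).
      by rewrite f'C//; have [] := h1 w (or_intror Cw) Aw.
    by rewrite f'n; [case: cf => + _; apply|case].
  - by rewrite f'B//; have [] := h2 w (or_introl Bw) Aw.
  - have [Cw|nC] := pselect (C w).
      by rewrite f'C//; have [] := h2 w (or_intror Cw) Aw.
    by rewrite f'n; [case: cf => _; apply|case].
move=> E mE.
rewrite (prob_preimage_split P bf.1 mB mC mE BC fB fC).
rewrite (prob_preimage_split P bf'.1 mB mC mE BC f'B f'C) mBC.
congr (_ + _); last by rewrite addrC.
congr prob; apply/seteqP; split => w [/= h n]; split => //=;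
  by rewrite ?f'n// -?f'n.
Qed.

(** Induction along the tree: average [f] over one half of [S], then over the other, and merge the
    two resulting values. *)
Lemma rho_fun_dyadic A b n S v f g : measurable A -> m A = 1 - p ->
  measurable S -> S `<=` A -> dyadic_step P b n S f v ->
  bounded_mfun f -> bounded_mfun g -> split_at A b f ->
  (forall w, S w -> g w = v) -> (forall w, ~ S w -> g w = f w) -> r f = r g.
Proof.
move=> mA mAp; elim: n S v f g => [|n IH] S v f g mS SA /= .
  move=> [bv fS] bf bg cf gS gn; congr r; apply/funext => w.
  by have [Sw|nS] := pselect (S w); [rewrite gS// fS|rewrite gn].
move=> [S0 [S1 [v0 [v1 [[mS0 mS1 SE S01 m01] [h0 h1 ve]]]]]] bf bg cf gS gn.
have S0A : S0 `<=` A by move=> w ?; apply: SA; rewrite SE; left.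
have S1A : S1 `<=` A by move=> w ?; apply: SA; rewrite SE; right.
have bv0 := dyadic_step_ge h0; have bv1 := dyadic_step_ge h1.
have cS S' v' h : b <= v' -> S' `<=` A -> split_at A b h ->
    split_at A b (splice S' (fun=> v') h).
  move=> bv' S'A [c1 c2]; split => w Aw.
    have [S'w|?] := pselect (S' w); first by rewrite splice_in.
    by rewrite splice_notin//; exact: c1.
  by rewrite splice_notin; [exact: c2|move=> /S'A].
pose f0 := splice S0 (fun=> v0) f; pose f1 := splice S1 (fun=> v1) f0.
have cf0 : split_at A b f0 by exact: cS.
have cf1 : split_at A b f1 by exact: cS.
have bf0 : bounded_mfun f0 by apply: bounded_mfun_splice => //;
  exact: bounded_mfun_cst.
have bf1 : bounded_mfun f1 by apply: bounded_mfun_splice => //;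
  exact: bounded_mfun_cst.
have disj w : S0 w -> S1 w -> False.
  by move=> a0 a1; have : (S0 `&` S1) w by []; rewrite S01.
rewrite (IH S0 v0 f f0)//; last 2 first.
- by move=> w ?; rewrite /f0 splice_in.
- by move=> w ?; rewrite /f0 splice_notin.
rewrite (IH S1 v1 f0 f1)//; last 3 first.
- apply: dyadic_step_eq h1 => w S1w; rewrite /f0 splice_notin// => /disj; exact.
- by move=> w ?; rewrite /f1 splice_in.
- by move=> w ?; rewrite /f1 splice_notin.
apply: (rho_fun_merge bf1 bg mA mAp cf1 mS0 mS1 S01 m01 (u := v0) (v := v1)).
- move=> w S0w; rewrite /f1 splice_notin; last exact: disj.
  by rewrite /f0 splice_in.
- by move=> w S1w; rewrite /f1 splice_in.
- by [].
- by move=> w [/S0A|/S1A].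
- by move=> w SS; rewrite gS// SE.
- move=> w nS; rewrite /f1 splice_notin; last by move=> ?; apply: nS; right.
  rewrite /f0 splice_notin; last by move=> ?; apply: nS; left.
  by apply: gn; rewrite SE.
Qed.

(* Halve the set carrying the low value repeatedly while keeping its mean: by
   [rho_fun_merge] the risk does not change, and the functions converge to the
   constant [a], so lower semicontinuity applies. *)
Lemma rho_fun_lift A (a b : R) : measurable A -> m A = 1 - p -> b <= a ->
  a <= r (splice A (fun=> a) (fun=> b)).
Proof.
move=> mA mAp ba.
have [N [C_ [mN N0 C0 mC [Cm Cw]]]] := vanishing_halving_sets hP (measurableC mA).
have CA n w : C_ n w -> ~ A w.
  move=> Cn; have : C_ 0%N w by elim: n Cn => // n IH /(mC n).2.
  by rewrite C0 => -[].
pose f_ n := splice (C_ n) (fun=> a + 2 ^+ n * (b - a)) (fun=> a).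
have fle n : a + 2 ^+ n * (b - a) <= a by rewrite gerDl mulr_ge0_le0
  ?exprn_ge0// subr_le0.
have bf n : bounded_mfun (f_ n).
  by apply: bounded_mfun_splice; [exact: (mC n).1|exact: bounded_mfun_cst..].
have cf n : split_at A a (f_ n).
  split => w Aw; first by rewrite /f_ splice_notin// => /CA.
  have [Cn|?] := pselect (C_ n w); first by rewrite /f_ splice_in.
  by rewrite /f_ splice_notin.
(* The values [a + 2 ^+ n.+1 * (b - a)] and [a], on the two halves of [C_ n], have mean
   [a + 2 ^+ n * (b - a)]. *)
have fS n : r (f_ n.+1) = r (f_ n).
  have mD : measurable (C_ n `\` C_ n.+1) by apply: measurableD;
    exact: (mC _).1.
  apply: (rho_fun_merge (bf n.+1) (bf n) mA mAp (cf n.+1) (mC n.+1).1 mD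
            (u := a + 2 ^+ n.+1 * (b - a)) (v := a)).
  - by rewrite setDIK.
  - rewrite probD; [|exact: (mC _).1|exact: (mC _).1|exact: (mC n).2].
    by rewrite !Cm exprS; lra.
  - by move=> w ?; rewrite /f_ splice_in.
  - by move=> w [_ ?]; rewrite /f_ splice_notin.
  - by move=> w [/CA|[/CA]].
  - by move=> w _ _; split.
  - move=> w [/(mC n).2|[]] ? *; rewrite /f_ splice_in//; rewrite exprS; lra.
  - move=> w h; rewrite /f_ !splice_notin// => ?; apply: h; first by left.
    by have [?|?] := pselect (C_ n.+1 w); [left|right].
have r0 n : r (f_ n) = r (f_ 0%N) by elim: n => // n <-; rewrite fS.
have bg : bounded_mfun (splice A (fun=> a) (fun=> b)).
  by apply: bounded_mfun_splice => //; exact: bounded_mfun_cst.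
apply: (@le_trans _ _ (r (f_ 0%N))).
  rewrite -{1}(rho_fun_cst a); apply: (rho_fun_lsc bf (bounded_mfun_cst T a) _
    r0) => w.
  apply/cvgrPdist_lt => e e0; apply: filterS (Cw w) => n nC.
  by rewrite /f_ splice_notin// subrr normr0.
(* [f_ 0] agrees with the target off the null set [N], hence has the same law. *)
apply: (rho_fun_law (A := A) (b := a)) => //.
  split => w Aw; first by rewrite splice_in.
  by rewrite splice_notin.
move=> E mE; apply: (prob_preimage_ae (bf 0%N).1 bg.1 mE mN N0) => w nN.
have [Aw|nA] := pselect (A w).
  by rewrite (splice_in _ _ Aw) /f_ splice_notin// => /CA.
rewrite (splice_notin _ _ nA) /f_ splice_in; last by rewrite C0.
by rewrite expr0; lra.
Qed.

(* The upper bound replaces [f] by its threshold off [A], the lower bound by the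
   constant [K]; averaging over the leaves then leaves a two-valued function. *)
Lemma rho_fun_sandwich A b K n f L U vL vU : measurable A -> m A = 1 - p ->
  bounded_mfun f -> bounded_mfun L -> bounded_mfun U ->
  split_at A b f -> (forall w, K <= f w) -> K <= b ->
  dyadic_step P b n A L vL -> dyadic_step P b n A U vU ->
  (forall w, A w -> L w <= f w <= U w) -> vL <= r f <= vU.
Proof.
move=> mA mAp bf bL bU [cf1 cf2] Kf Kb dL dU LU.
have bspl h h' : bounded_mfun h -> bounded_mfun h' -> bounded_mfun (splice A h
  h').
  exact: bounded_mfun_splice.
have bc (c : R) := bounded_mfun_cst T c.
have D c h v : c <= b -> bounded_mfun h -> dyadic_step P b n A h v ->
    r (splice A h (fun=> c)) = r (splice A (fun=> v) (fun=> c)).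
  move=> cb bh dh; apply: (@rho_fun_dyadic A b n A v) => //; try exact: bspl.
  - by apply: dyadic_step_eq dh => w Aw; rewrite splice_in.
  - split => w Aw; first by rewrite splice_in//; exact: dyadic_step_ge_in dh Aw.
    by rewrite splice_notin.
  - by move=> w Aw; rewrite splice_in.
  - by move=> w Aw; rewrite !splice_notin.
apply/andP; split.
  apply: (@le_trans _ _ (r (splice A L (fun=> K)))).
    rewrite (D _ _ vL)//; apply: rho_fun_lift => //.
    by apply: le_trans Kb _; exact: dyadic_step_ge dL.
  apply: rho_fun_le => // [|w]; first exact: bspl.
  have [Aw|nA] := pselect (A w); first by rewrite splice_in//;
    have /andP[] := LU w Aw.
  by rewrite splice_notin.
apply: (@le_trans _ _ (r (splice A U (fun=> b)))).
  apply: rho_fun_le => // [|w]; first exact: bspl.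
  have [Aw|nA] := pselect (A w); first by rewrite splice_in//;
    have /andP[] := LU w Aw.
  by rewrite splice_notin//; exact: cf2.
rewrite (D _ _ vU)// -[leRHS]rho_fun_cst; apply: rho_fun_le => // [|w];
  first exact: bspl.
have [Aw|nA] := pselect (A w); first by rewrite splice_in.
by rewrite splice_notin//; exact: dyadic_step_ge dU.
Qed.
End concentration_averse.

(** * From bounded to q-integrable random variables *)

Section truncation.
Context (d : measure_display) (T : measurableType d) (R : realType)
  (P : probability T R).

Definition truncation (k : nat) (f : T -> R) : T -> R :=
  fun w => Num.max (- k%:R) (Num.min (f w) k%:R).

Lemma bounded_mfun_truncation k f : measurable_fun setT f ->
  bounded_mfun (truncation k f).
Proof.
move=> mf; split; first by apply: measurable_maxr => //; exact: measurable_minr.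
exists k%:R => w; rewrite /truncation ler_norml le_max lexx/= ge_max ge_min
  lexx orbT andbT.
by rewrite (@le_trans _ _ 0)// lerNl oppr0.
Qed.

Lemma truncation_id k f w : `|f w| <= k%:R -> truncation k f w = f w.
Proof.
by rewrite ler_norml => /andP[h1 h2]; rewrite /truncation min_l// max_r.
Qed.

Lemma truncation_dist k f w : `|truncation k f w - f w| <= `|f w|.
Proof.
have [h|h] := leP `|f w| k%:R; first by rewrite truncation_id// subrr normr0.
have k0 : 0 <= k%:R :> R by [].
have [f0|f0] := leP 0 (f w).
  rewrite ger0_norm// in h *; rewrite /truncation min_r; last exact: ltW.
  by rewrite max_r ?ler0_norm; lra.
rewrite ltr0_norm// in h *; rewrite /truncation min_l; last lra.
by rewrite max_l ?ger0_norm; lra.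
Qed.

Lemma truncation_Lnorm_small (q : R) f e : 1 <= q -> f \in Lfun P q%:E -> 0 < e
  ->
  \forall k \near \oo, ('N[P]_q%:E[EFin \o (fun w => (truncation k f w - f
    w)%R)] < e%:E)%E.
Proof.
move=> q1 lf e0; have q0 : 0 < q by exact: lt_le_trans q1.
have mf : measurable_fun setT f by move: lf; rewrite inE => /andP[/[!inE]].
have iq := Lfun_integrable q1 lf.
have mt k : measurable_fun setT (fun w => truncation k f w - f w).
  by apply: measurable_funB => //; have [] := bounded_mfun_truncation k mf.
pose g k w : \bar R := (`|truncation k f w - f w| `^ q)%:E.
have mg k : measurable_fun setT (g k).
  apply/measurable_EFinP; apply: (measurableT_comp (measurable_powR q)).
  exact: measurableT_comp.
have [_ _ cv] : [/\ P.-integrable setT (cst 0%E : T -> \bar R),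
    (\int[P]_w `|g k w - cst 0%E w|)%E @[k --> \oo] --> 0%E
    & (\int[P]_w g k w)%E @[k --> \oo] --> (\int[P]_w cst 0%E w)%E].
  apply: (dominated_convergence measurableT mg _ _ iq) => //.
    apply: aeW => w _; apply: (@cvg_near_cst _ _ _ _ _ _).
    exists (Num.truncn `|f w|).+1 => // k /= hk.
    rewrite /g truncation_id ?subrr ?normr0 ?powR0 ?gt_eqF//.
    apply: le_trans (ltW (truncnS_gt _)) _; by rewrite ler_nat.
  apply: aeW => w k _; rewrite /g /= lee_fin ger0_norm ?powR_ge0//.
  by apply: ge0_ler_powR; rewrite ?nnegrE ?(ltW q0)//; exact: truncation_dist.
rewrite integral0 in cv.
have : \forall k \near \oo, (\int[P]_w g k w < (e `^ q)%:E)%E.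
  move/fine_cvgP: cv => [fi /cvgr_lt/(_ (e `^ q) (powR_gt0 _ e0))].
  by apply: filterS2 fi => k kfin; rewrite -lte_fin fineK.
apply: filterS => k; rewrite !ltNge; apply: contra => h.
have -> : (\int[P]_w g k w)%E = ('N[P]_q%:E[EFin \o (fun w => truncation k f w
  - f w)%R] `^ q)%E.
  by rewrite powR_Lnorm ?gt_eqF.
rewrite -poweR_EFin; apply: gt0_ler_poweR => //; first exact: ltW.
  by rewrite in_itv/= leey andbT lee_fin ltW.
by rewrite in_itv/= leey andbT Lnorm_ge0.
Qed.
End truncation.

Section ES_continuity.
Context (d : measure_display) (T : measurableType d) (R : realType)
  (P : probability T R) (hP : atomless P)
  (p : R) (p0 : 0 < p) (p1 : p < 1) (q : R) (hq : (1 <= q%:E)%E).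
Implicit Types X Y : LfunType P hq.

(** Evaluate both variables on the event attaining one of the two values; there the other one is
    bounded below by its tail mean. *)
Lemma ES_lipschitz X Y :
  `|ES P p X - ES P p Y| <= (1 - p)^-1 * \int[P]_w `|X w - Y w|.
Proof.
have p10 : 0 < (1 - p)^-1 by rewrite invr_gt0 subr_gt0.
have H (Z W : LfunType P hq) :
    ES P p Z - ES P p W <= (1 - p)^-1 * \int[P]_w `|Z w - W w|.
  have [A [mA mAp ->]] := ES_attained hP p0 p1 Z.
  have iZ := Lfun_integrable_setT Z; have iW := Lfun_integrable_setT W.
  have iD := integrableB measurableT iZ iW.
  apply: (@le_trans _ _ ((1 - p)^-1 * \int[P]_(w in A) (Z w - W w))).
    rewrite RintegralB ?mulrBr//; [|exact: integrable_sub mA iZ|exact: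
      integrable_sub mA iW].
    by rewrite lerD2l lerN2; exact: (ES_ge hP p0 p1 iW).
  rewrite ler_pM2l// Rintegral_mkcond; apply: le_Rintegral => //.
  - rewrite -restrict_EFin; apply/(integrable_mkcond _ mA).
    exact: (integrableS measurableT mA _ iD).
  - exact: (integrable_abse iD).
  - move=> w _; rewrite patchE; case: ifPn => _;
    [exact: ler_norm|exact: normr_ge0].
rewrite ler_norml; apply/andP; split; last exact: H.
rewrite lerNl opprB; apply: le_trans (H Y X) _.
by under eq_Rintegral do rewrite distrC.
Qed.
End ES_continuity.

(** * Uniqueness on bounded functions and conclusion *)

Section uniqueness.
Context (d : measure_display) (T : measurableType d) (R : realType)
  (P : probability T R) (hP : atomless P)
  (p : R) (p0 : 0 < p) (p1 : p < 1) (q : R) (hq : (1 <= q%:E)%E).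

Definition tail_risk_axioms (rho : LfunType P hq -> R) :=
  [/\ monotonicity rho, translation_invariance rho, lower_semicontinuity rho,
      p_concentration_aversion p rho & rho 0 = 0].

Lemma ES_tail_risk_axioms (rho : LfunType P hq -> R) : (forall X, rho X = ES P
  p X) -> tail_risk_axioms rho.
Proof.
move=> /funext ->; split.
- exact: ES_le.
- exact: ES_translation.
- move=> X_ X; exact: ES_lower_semicontinuous.
- move=> X Y X' Y'; exact: ES_concentration_aversion.
- exact: ES0.
Qed.

(* The bounds of [rho_fun_sandwich] do not depend on the functional, so two
   functionals satisfying the axioms cannot be told apart on bounded [X]. *)
Lemma eq_on_bounded (rho rho' : LfunType P hq -> R) (X : LfunType P hq) :
  tail_risk_axioms rho -> tail_risk_axioms rho' -> bounded_mfun X -> rho X =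
    rho' X.
Proof.
move=> [M1 T1 L1 C1 Z1] [M2 T2 L2 C2 Z2] bX.
have [c [A [mA mAp [h1 h2] _ _]]] := tail_quantile hP p0 p1 X.
have [K XK] := bX.2.
have A0 : 0 < prob P A by rewrite mAp subr_gt0.
have A1 : 0 < prob P (~` A) by rewrite probC// mAp opprB addrC subrK.
have [w1 Aw1] := prob_gt0_ex A0; have [w2 nAw2] := prob_gt0_ex A1.
(* One point on each side of the split places the threshold between [- K] and [K]. *)
have cK : c <= K by apply: le_trans (h1 _ Aw1) (le_trans (ler_norm _) (XK w1)).
have Kc : - K <= c by apply: le_trans (h2 _ nAw2); rewrite lerNl;
  apply: le_trans (XK w2); rewrite -normrN ler_norm.
suff H n : `|rho X - rho' X| <= 2^-1 ^+ n * (K - c).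
  apply/eqP; rewrite -subr_eq0 -normr_le0; apply: (@cvgr_to_ge _ \oo _ _ (fun n
    => 2^-1 ^+ n * (K - c))).
    rewrite -[0](mul0r (K - c)); apply: cvgMr_tmp; apply: cvg_expr.
    by rewrite ger0_norm//; lra.
  exact: nearW.
have [|L [U [l [u [bL bU dL dU [LU e]]]]]] :=
    dyadic_step_sandwich hP n (measurable_funPT X) mA A0 (lexx c) cK.
  move=> w Aw; rewrite h1//=; exact: le_trans (ler_norm _) (XK w).
have KX w : - K <= X w by rewrite lerNl; apply: le_trans (XK w);
  rewrite -normrN ler_norm.
have /andP[a1 a2] := rho_fun_sandwich hP p0 p1 M1 T1 L1 C1 Z1 mA mAp bX bL bU
  (conj h1 h2) KX Kc dL dU LU.
have /andP[b1 b2] := rho_fun_sandwich hP p0 p1 M2 T2 L2 C2 Z2 mA mAp bX bL bU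
  (conj h1 h2) KX Kc dL dU LU.
rewrite !(@rho_funE _ _ _ _ _ _ _ X)// in a1 a2 b1 b2.
rewrite -e ler_norml; lra.
Qed.
End uniqueness.

Theorem proposition6 (d : measure_display) (T : measurableType d)
  (R : realType) (P : probability T R) (hP : atomless P)
  (p : R) (hp0 : 0 < p) (hp1 : p < 1)
  (q : R) (hq : (1 <= q%:E)%E)
  (rho : LfunType P hq -> R) (hrho : Lnorm_continuous rho) :
  [/\ monotonicity rho,
      translation_invariance rho,
      lower_semicontinuity rho,
      p_concentration_aversion p rho
    & rho 0 = 0]
  <-> (forall X : LfunType P hq, rho X = ES P p X).
Proof.
split=> [ax X|]; last exact: ES_tail_risk_axioms.
have axES : tail_risk_axioms p (ES P p : LfunType P hq -> R) by exact:
  ES_tail_risk_axioms.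
apply/eqP; rewrite -subr_eq0 -normr_le0; apply/ler_addgt0Pl => e e0;
  rewrite addr0.
have e2 : 0 < e / 2 by rewrite divr_gt0.
have [delta delta0 hdelta] := hrho X _ e2.
have q1 : 1 <= q by rewrite -lee_fin.
have mX : measurable_fun setT X by exact: measurable_funPT.
have lX1 : (X : T -> R) \in Lfun P 1 by apply/Lfun1_integrable;
  exact: Lfun_integrable_setT.
have e3 : 0 < (1 - p) * (e / 2) by rewrite mulr_gt0// subr_gt0.
(* One truncation level must serve twice: closeness in [L^q] for the continuity of [rho], and
   closeness in [L^1], scaled by [1 - p], for the Lipschitz bound of Expected Shortfall. *)
have n1 := truncation_Lnorm_small q1 (LfunP X) delta0.
have n2 := truncation_Lnorm_small (lexx 1) lX1 e3.
have [k [k1 k2]] : exists k, ('N[P]_q%:E[EFin \o (fun w => (truncation k X w -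
  X w)%R)] < delta%:E)%E /\
   ('N[P]_1%:E[EFin \o (fun w => (truncation k X w - X w)%R)] < ((1 - p) * (e /
     2))%:E)%E.
  have [k] := filter_ex (filterI n1 n2); by exists k.
have bt := bounded_mfun_truncation k mX.
pose Y : LfunType P hq := Lfun_Sub hq (bounded_mfun_Lfun P hq bt).
have rY : rho Y = ES P p Y by exact: (eq_on_bounded hP hp0 hp1 ax axES).
have d1 : `|rho Y - rho X| < e / 2 by apply: hdelta.
have d2 : `|ES P p Y - ES P p X| <= e / 2.
  apply: le_trans (ES_lipschitz hP hp0 hp1 Y X) _.
  rewrite ler_pdivrMl ?subr_gt0//.
  rewrite Lnorm1 in k2; apply: ltW; rewrite -lte_fin; apply: le_lt_trans k2.
  rewrite /Rintegral fineK//.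
  apply: integrable_fin_num => //; apply: (integrable_abse (f := EFin \o (fun w
    => Y w - X w))).
  exact: (integrableB measurableT (Lfun_integrable_setT Y)
    (Lfun_integrable_setT X)).
rewrite (_ : rho X - ES P p X = (ES P p Y - ES P p X) - (rho Y - rho X));
  last by rewrite rY; lra.
apply: le_trans (ler_normB _ _) _.
rewrite [leRHS]splitr; apply: lerD => //; exact: ltW.
Qed.
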